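(* Let $N\geq 2$ and let $P(z)=a_0+a_1z+\cdots+a_Nz^N$ with $a_0,\dots,a_N\in\mathbb{C}$ and $a_0a_N\neq 0$. Let $f(z)=P(e^z)/e^z$, let $A(f)$ be the fast escaping set of $f$, and $A(f)^c=\mathbb{C}\setminus A(f)$. Let $K,K_0,R_3,R_6$ be the constants depending on $P$ defined in the context. Let $r,c_1,x^*$ be any positive constants satisfying $$r\leq\frac{1}{4N},\qquad c_1\geq \frac{32\sqrt{2}}{K_0 r}+\frac{1}{4K_0^2}+\frac{12\sqrt{2}}{K_0},\qquad x^{*}\geq\max\{R_3,\ R_6,\ 6\log 2,\ 12+2\log c_1\}.$$ Then for every horizontal strip $S\subset\mathbb{C}$ of width $2\pi$, $$\operatorname{Area}(S\cap A(f)^c)\leq (4\pi+4r)\left(x^{*}+r+8c_1\, e^{4-x^*/2}\,\frac{r}{1-e^{-r/2}}\right)<\infty.$$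
   Context: Area means two-dimensional Lebesgue measure. A horizontal strip of width $2\pi$ is a set $\{z\in\mathbb{C}: a\leq \operatorname{Im} z\leq a+2\pi\}$ with $a\in\mathbb{R}$. $\mathbb{N}$ denotes the natural numbers, including $0$. Constants attached to $P$: $$K:=\max\{|a_0|,|a_1|,\dots,|a_N|\},\qquad K_0:=\min\{|a_0|,|a_N|\},\qquad R_3:=\log\Big(2+\frac{8K}{K_0}\Big),$$ $$R_4:=1+\max\Big\{\frac{2K+4}{|a_N|},\ \frac{K}{|a_N|}\Big(\frac{2N^2}{N-1}+1\Big)\Big\},\qquad R_5:=\min\Big\{\frac{|a_0|}{2(KN+2)},\ \frac{1}{2N}\sqrt{\frac{|a_0|}{K}}\Big\},$$ $$R_6:=\max\{\log R_4,\,-\log R_5\}.$$ For a transcendental entire function $f$, $f^{\circ n}$ denotes its $n$-th iterate. The maximal modulus function is $M(r)=M(r,f):=\max_{|z|=r}|f(z)|$ for $r>0$, and $M^{\circ n}$ denotes the $n$-th iterate of $r\mapsto M(r)$. The fast escaping set is $$A(f):=\{z\in\mathbb{C}: \text{ there is } \ell\in\mathbb{N} \text{ such that } |f^{\circ(n+\ell)}(z)|\geq M^{\circ n}(R) \text{ for all } n\in\mathbb{N}\},$$ where $R>0$ is a constant such that $M^{\circ n}(R)\to\infty$ as $n\to\infty$; it is known that $A(f)$ does not depend on the choice of such $R$. *)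

(* Defs.v *)
From HB Require Import structures.
From mathcomp Require Import all_boot all_order all_algebra.
From mathcomp Require Import complex.
From mathcomp Require Import all_classical all_reals all_analysis.

Set Implicit Arguments.
Unset Strict Implicit.
Unset Printing Implicit Defensive.

Import Order.TTheory GRing.Theory Num.Theory.
Import numFieldNormedType.Exports.

Local Open Scope classical_set_scope.
Local Open Scope complex_scope.
Local Open Scope ring_scope.

Notation cabs := ComplexField.Normc.normc.

Definition cexp {R : realType} (z : R[i]) : R[i] :=
  (expR (complex.Re z) * cos (complex.Im z)) +i*
  (expR (complex.Re z) * sin (complex.Im z)).

(* Only meaningful for Borel sets: outside the product sigma-algebra the
   library's product measure is an unspecified value. *)
Definition area {R : realType} (A : set R[i]) : \bar R :=
  (@lebesgue_measure R \x @lebesgue_measure R)%E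
    [set p : R * R | A (p.1 +i* p.2)].

Definition hstrip {R : realType} (a : R) : set R[i] :=
  [set z | a <= complex.Im z <= a + 2 * pi].

(* For continuous f and r >= 0 the circle is compact and nonempty, so the
   supremum is the maximum. *)
Definition maxmod {R : realType} (f : R[i] -> R[i]) (r : R) : R :=
  sup [set cabs (f z) | z in [set z : R[i] | cabs z = r]].

Definition maxmod_escapes {R : realType} (f : R[i] -> R[i]) (R0 : R) : Prop :=
  (fun n => iter n (maxmod f) R0) @ \oo --> +oo.

(* The set A(f) computed from the starting radius R0; for transcendental entire
   f it is the same set for all R0 > 0 such that maxmod_escapes f R0. *)
Definition fast_escaping {R : realType} (f : R[i] -> R[i]) (R0 : R) :
    set R[i] :=
  [set z | exists l : nat, forall n : nat,
     iter n (maxmod f) R0 <= cabs (iter (n + l)%N f z)].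

Definition expquot {R : realType} (P : {poly R[i]}) (z : R[i]) : R[i] :=
  P.[cexp z] / cexp z.

Section Constants.
Context {R : realType} (N : nat) (P : {poly R[i]}).

Definition cstK : R := \big[Num.max/0]_(i < N.+1) cabs P`_i.

Definition cstK0 : R := Num.min (cabs P`_0) (cabs P`_N).

Definition cstR3 : R := ln (2 + 8 * cstK / cstK0).

Definition cstR4 : R :=
  1 + Num.max ((2 * cstK + 4) / cabs P`_N)
        (cstK / cabs P`_N * (2 * N%:R ^+ 2 / (N%:R - 1) + 1)).

Definition cstR5 : R :=
  Num.min (cabs P`_0 / (2 * (cstK * N%:R + 2)))
    ((2 * N%:R)^-1 * Num.sqrt (cabs P`_0 / cstK)).

Definition cstR6 : R := Num.max (ln cstR4) (- ln cstR5).

End Constants.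

(* Main.v *)
(* Call a point slow if |Re f^(k+1)| < exp (|Re f^k| / 2) for some k along its
   orbit.  A point with large |Re| that is not slow escapes at least as fast as the
   iterates of x |-> e^(x/2), which overtake those of M because M(rho) <= C e^(N rho);
   so it suffices to bound the area of the slow points.  Let D = 8 c_1 e^4.  On a
   square Q of side r in {|Re z| >= x}, x >= x*, one exponential dominates f, so f
   expands distances on Q by a factor comparable to some mu >= K_0 e^x.  Hence f(Q)
   lies in a horizontal strip of height O(mu r), and preimages in Q of sets shrink in
   area by O(mu^-2).  If the points slow within n steps have density at most
   D e^(-x/2) in every such square, then summing over the squares of the strip (plus
   the central part |Re w| < e^((x+r)/2)) and pulling back gives the same density
   bound for n+1 steps.  Only one step of f is pulled back at a time, so no distortion
   estimate for iterates is needed. *)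

Require Import Defs.
From HB Require Import structures.
From mathcomp Require Import all_boot all_order all_algebra.
From mathcomp Require Import complex.
From mathcomp Require Import all_classical all_reals all_analysis.
From mathcomp Require Import ring lra.

Set Implicit Arguments.
Unset Strict Implicit.
Unset Printing Implicit Defensive.

Import Order.TTheory GRing.Theory Num.Theory.
Import numFieldNormedType.Exports.

Local Open Scope classical_set_scope.
Local Open Scope complex_scope.
Local Open Scope ring_scope.

(** * The complex exponential *)

Section complex_exponential.
Variable R : realType.
Implicit Types (z w u : R[i]) (t : R).

Lemma cexpD z w : cexp (z + w) = cexp z * cexp w.
Proof.
case: z w => [a b] [c d]; rewrite /cexp /= expRD cosD sinD.
by apply/eqP; rewrite eq_complex /=; apply/andP; split; apply/eqP; ring.
Qed.

Lemma cexp0 : cexp (0 : R[i]) = 1.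
Proof. by rewrite /cexp /= expR0 cos0 sin0 mulr1 mulr0. Qed.

Lemma normc_cexp z : cabs (cexp z) = expR (complex.Re z).
Proof.
case: z => a b /=; rewrite !exprMn -mulrDr cos2Dsin2 mulr1 sqrtr_sqr.
by rewrite ger0_norm // expR_ge0.
Qed.

Lemma cexp_neq0 z : cexp z != 0.
Proof.
apply/eqP => /(congr1 (fun x => cabs x)); rewrite normc_cexp.
by rewrite ComplexField.Normc.normc0 => /eqP; rewrite gt_eqF // expR_gt0.
Qed.

Lemma cexpN z : cexp (- z) = (cexp z)^-1.
Proof.
by apply: (mulIf (cexp_neq0 z)); rewrite -cexpD addNr cexp0 mulVf // cexp_neq0.
Qed.

Lemma cexpMn z n : cexp (n%:R * z) = cexp z ^+ n.
Proof.
elim: n => [|n IHn]; first by rewrite mul0r cexp0 expr0.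
by rewrite exprS -IHn -cexpD -natr1 mulrDl mul1r addrC.
Qed.

Lemma Re_realM t z : complex.Re (t%:C * z) = t * complex.Re z.
Proof. by case: z => a b /=; rewrite mul0r subr0. Qed.

Lemma Im_realM t z : complex.Im (t%:C * z) = t * complex.Im z.
Proof. by case: z => a b /=; rewrite mul0r addr0. Qed.

Lemma normc_ge0 z : 0 <= cabs z.
Proof. by case: z => a b /=; exact: sqrtr_ge0. Qed.

Lemma sqr_normc z : cabs z ^+ 2 = complex.Re z ^+ 2 + complex.Im z ^+ 2.
Proof. by case: z => a b /=; rewrite sqr_sqrtr // addr_ge0 // sqr_ge0. Qed.

Lemma normc_real t : cabs t%:C = `|t|.
Proof. by rewrite /= expr0n /= addr0 sqrtr_sqr. Qed.

Lemma normc_geRe z : `|complex.Re z| <= cabs z.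
Proof.
rewrite -(@ler_pXn2r _ 2) ?nnegrE ?normc_ge0 ?normr_ge0 // sqr_normc real_normK ?num_real //.
by rewrite lerDl sqr_ge0.
Qed.

Lemma normc_geIm z : `|complex.Im z| <= cabs z.
Proof.
rewrite -(@ler_pXn2r _ 2) ?nnegrE ?normc_ge0 ?normr_ge0 // sqr_normc real_normK ?num_real //.
by rewrite lerDr sqr_ge0.
Qed.

(** [10 / 7] is a rational upper bound for the square root of 2, which keeps the later estimates
    within rational arithmetic. *)
Lemma normc_le_max z s : 0 <= s -> `|complex.Re z| <= s -> `|complex.Im z| <= s ->
  cabs z <= 10 / 7 * s.
Proof.
move=> s0 hR hI.
rewrite -(@ler_pXn2r _ 2) ?nnegrE ?normc_ge0 ?mulr_ge0 // sqr_normc.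
rewrite -(real_normK (num_real (complex.Re z))) -(real_normK (num_real (complex.Im z))).
have h1 : `|complex.Re z| ^+ 2 <= s ^+ 2 by rewrite ler_pXn2r ?nnegrE.
have h2 : `|complex.Im z| ^+ 2 <= s ^+ 2 by rewrite ler_pXn2r ?nnegrE.
rewrite exprMn; have := sqr_ge0 s; move: h1 h2; set A := _ ^+ 2; set B := `|complex.Im z| ^+ 2.
by set C := s ^+ 2; lra.
Qed.

Lemma le_normc_sum (I : Type) (s : seq I) (Q : pred I) (F : I -> R[i]) :
  cabs (\sum_(i <- s | Q i) F i) <= \sum_(i <- s | Q i) cabs (F i).
Proof.
elim/big_rec2: _ => [|i y x _ IH]; first by rewrite ComplexField.Normc.normc0.
by apply: (le_trans (le_normcD _ _)); rewrite lerD2l.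
Qed.

Lemma expR_le_inv t : t < 1 -> expR t <= (1 - t)^-1.
Proof.
move=> t1; rewrite -[expR t]invrK -expRN lef_pV2 ?posrE ?expR_gt0 ?subr_gt0 //.
exact: expR_ge1Dx.
Qed.

(** Both sides come from 1 + t <= e^t <= 1/(1 - t); the constants are the squares of 4/5 and 4/3. *)
Lemma expR_sub1_bounds t : `|t| <= 4^-1 ->
  16 / 25 * t ^+ 2 <= (expR t - 1) ^+ 2 <= 16 / 9 * t ^+ 2.
Proof.
move=> ht; have /andP[t1 t2] : - 4^-1 <= t <= 4^-1 by rewrite -ler_norml.
have h1 := expR_ge1Dx t.
have h2 : expR t <= (1 - t)^-1 by apply: expR_le_inv; lra.
have h3 : (1 - t)^-1 * (1 - t) = 1 by rewrite mulVf //; apply/eqP; lra.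
have h4 : expR t * (1 - t) <= 1 by rewrite -[leRHS]h3 ler_wpM2r //; lra.
move: h1 h4; set e := expR t => h1 h4.
have [t0|t0] := leP 0 t.
  have l1 : t <= e - 1 by lra.
  have l2 : e - 1 <= 4 / 3 * t by nra.
  by apply/andP; split; nra.
have l1 : 1 - e <= - t by lra.
have l2 : - t * (4 / 5) <= 1 - e by nra.
by apply/andP; split; nra.
Qed.

Lemma sin_sqr_le t : (sin t) ^+ 2 <= t ^+ 2.
Proof.
wlog t0 : t / 0 <= t.
  move=> H; have [/H//|t0] := leP 0 t.
  by have := H (- t); rewrite sinN !sqrrN; apply; lra.
have [c _] : exists2 c, c \in `[0, t] & sin t - sin 0 = cos c * (t - 0).
  apply: MVT_segment => //; apply: continuous_subspaceT => x.
  exact: continuous_sin.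
rewrite sin0 !subr0 => ->; rewrite exprMn.
have := cos2Dsin2 c; have := sqr_ge0 (sin c); have := sqr_ge0 t.
by move: (sin c ^+ 2) (cos c ^+ 2) (t ^+ 2) => A B C; nra.
Qed.

(** By the mean value theorem sin t = t cos c with c between 0 and t, and cos^2 c = 1 - sin^2 c >= 1
    - c^2 >= 63/64. *)
Lemma sin_sqr_ge t : `|t| <= 8^-1 -> 24 / 25 * t ^+ 2 <= (sin t) ^+ 2.
Proof.
wlog t0 : t / 0 <= t.
  move=> H; have [/H//|t0] := leP 0 t.
  by have := H (- t); rewrite sinN !sqrrN normrN; apply; lra.
rewrite ger0_norm // => t8.
have [c] : exists2 c, c \in `[0, t] & sin t - sin 0 = cos c * (t - 0).
  apply: MVT_segment => //; apply: continuous_subspaceT => x.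
  exact: continuous_sin.
rewrite in_itv /= => /andP[c0 ct].
rewrite sin0 !subr0 => ->; rewrite exprMn.
have := cos2Dsin2 c; have := sin_sqr_le c; have := sqr_ge0 t.
have : c ^+ 2 <= 1 / 64 by nra.
by move: (sin c ^+ 2) (cos c ^+ 2) (t ^+ 2) (c ^+ 2) => A B C D; nra.
Qed.

(** The half-angle formula 1 - cos b = 2 sin^2(b/2) splits the square into a term measuring Re u and
    a term measuring Im u. *)
Lemma sqr_normc_cexp_sub1 u : cabs (cexp u - 1) ^+ 2 =
  (expR (complex.Re u) - 1) ^+ 2 + 4 * expR (complex.Re u) * sin (complex.Im u / 2) ^+ 2.
Proof.
case: u => a b; rewrite sqr_normc /=.
have hc : cos b = 1 - 2 * sin (b / 2) ^+ 2.
  have -> : cos b = cos (b / 2 + b / 2) by rewrite -splitr.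
  by rewrite cosD; have := cos2Dsin2 (b / 2); rewrite !expr2; lra.
have := cos2Dsin2 b; move: (sin b) (cos b) hc => S C ->.
move: (sin (b / 2)) (expR a) => s e h.
have -> : (e * (1 - 2 * s ^+ 2) - 1) ^+ 2 + (e * S - 0) ^+ 2 = e ^+ 2 * ((1 - 2 * s ^+ 2) ^+ 2 + S ^+ 2)
   - 2 * e * (1 - 2 * s ^+ 2) + 1 by ring.
by rewrite h; ring.
Qed.

(** Since e^(Re u) lies in [3/4, 4/3], the sine term lies between 18/25 and 4/3 times (Im u)^2,
    which fits between the squares of 4/5 and 4/3. *)
Lemma cexp_sub1_bounds u :
  `|complex.Re u| <= 4^-1 -> `|complex.Im u| <= 4^-1 ->
  4 / 5 * cabs u <= cabs (cexp u - 1) <= 4 / 3 * cabs u.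
Proof.
move=> ha hb.
have e1 : 3 / 4 <= expR (complex.Re u).
  apply: le_trans (expR_ge1Dx _); move: ha; rewrite ler_norml => /andP[]; lra.
have e2 : expR (complex.Re u) <= 4 / 3.
  move: ha; rewrite ler_norml => /andP[_ ha].
  apply: (le_trans (expR_le_inv _)); first lra.
  rewrite -[leRHS]invrK lef_pV2 ?posrE ?invr_gt0; lra.
have /andP[h1 h2] := expR_sub1_bounds ha.
have s1 := sin_sqr_le (complex.Im u / 2).
have s2 : 24 / 25 * (complex.Im u / 2) ^+ 2 <= sin (complex.Im u / 2) ^+ 2.
  by apply: sin_sqr_ge; rewrite normrM [`|2^-1|]ger0_norm //; move: hb; lra.
move: s1 s2; rewrite !exprMn => s1 s2.
have n := sqr_normc_cexp_sub1 u.
have n0 := sqr_normc u.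
have a0 := sqr_ge0 (complex.Re u); have b0 := sqr_ge0 (complex.Im u).
move: s1 s2 n h1 h2 n0 a0 b0.
move: (expR _) (sin _ ^+ 2) (complex.Re u ^+ 2) (complex.Im u ^+ 2) e1 e2.
move=> e S A B e1 e2 s1 s2 n h1 h2 n0 a0 b0.
apply/andP; split; rewrite -(@ler_pXn2r _ 2) ?nnegrE ?mulr_ge0 ?normc_ge0 // exprMn n n0; nra.
Qed.

End complex_exponential.

(** * Exponential sums dominated by one term *)

(** The bound k + 1 <= 2^k reduces the sum to a geometric one of ratio 2q <= 1/32. *)
Lemma sum_natr_expr_le {R : realType} (q : R) (n : nat) : 0 <= q <= 64^-1 ->
  \sum_(i < n) i.+1%:R * q ^+ i.+1 <= 32 / 31 * q.
Proof.
move=> /andP[q0 q1].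
have le1 : \sum_(i < n) i.+1%:R * q ^+ i.+1 <= q * \sum_(i < n) (2 * q) ^+ i.
  rewrite mulr_sumr; apply: ler_sum => i _.
  rewrite exprS mulrCA exprMn ler_wpM2l // ler_wpM2r ?exprn_ge0 //.
  by rewrite -natrX ler_nat ltn_expl.
apply: (le_trans le1); rewrite mulrC ler_wpM2r //.
have T0 : 0 <= (2 * q) ^+ n by rewrite exprn_ge0 // mulr_ge0.
have := subrX1 (2 * q) n; move: T0.
by move: (\sum_(i < n) _) ((2 * q) ^+ n) => S T T0 e; nra.
Qed.

Section exponential_sums.
Variable R : realType.
Implicit Types (z w : R[i]) (b : nat -> R[i]).

(** The exponents m - j decrease, so [b 0] goes with the largest one; a Laurent polynomial in e^z
    has this shape when read from either end. *)
Definition expsum (N : nat) b (m : nat) z : R[i] :=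
  \sum_(j < N.+1) b j * cexp ((m%:R - j%:R : R)%:C * z).

(* On [Re w >= 0] the term [j = 0] dominates; [|m - j| <= m * j] turns the sum of
   the increments of the others into a multiple of [\sum_j j q^j], [q = e^(-Re w)]. *)
Lemma expsum_bounds (N m : nat) b (K : R) z w :
  (0 < m <= N)%N ->
  N%:R * `|complex.Re (z - w)| <= 4^-1 -> N%:R * `|complex.Im (z - w)| <= 4^-1 ->
  (forall j, (j <= N)%N -> cabs (b j) <= K) ->
  64 <= expR (complex.Re w) -> 8 * K <= cabs (b 0%N) * expR (complex.Re w) ->
  31 / 50 * (cabs (b 0%N) * m%:R * expR (m%:R * complex.Re w)) * cabs (z - w)
    <= cabs (expsum N b m z - expsum N b m w)
    <= 38 / 25 * (cabs (b 0%N) * m%:R * expR (m%:R * complex.Re w)) * cabs (z - w).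
Proof.
move=> /andP[m0 mN] hR hI hK h64 h8.
set u := z - w; set M := _ * m%:R * _.
have e0 := expR_gt0 (complex.Re w).
set q := expR (- complex.Re w).
have q0 : 0 < q by exact: expR_gt0.
have qe : q * expR (complex.Re w) = 1 by rewrite -expRD addNr expR0.
have q64 : q <= 64^-1 by nra.
have Kq : K * q <= cabs (b 0%N) / 8.
  have : 8 * K * q <= cabs (b 0%N) * (q * expR (complex.Re w)) by rewrite mulrCA mulrC ler_wpM2l // ltW.
  by rewrite qe; lra.
pose t (j : nat) : R := m%:R - j%:R.
have tN j : (j <= N)%N -> `|t j| <= N%:R.
  move=> jN; rewrite ler_norml /t.
  have : j%:R <= N%:R :> R by rewrite ler_nat.
  have : m%:R <= N%:R :> R by rewrite ler_nat.
  have := ler0n R j; have := ler0n R m; lra.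
pose D j := b j * cexp ((t j)%:C * w) * (cexp ((t j)%:C * u) - 1).
have eD : expsum N b m z - expsum N b m w = \sum_(j < N.+1) D j.
  rewrite -sumrB; apply: eq_bigr => j _; rewrite /D /t mulrBr mulr1 -mulrA -cexpD -mulrDr.
  by rewrite /u [w + _]addrC subrK.
have bd j : (j <= N)%N ->
    4 / 5 * (`|t j| * cabs u) <= cabs (cexp ((t j)%:C * u) - 1) <= 4 / 3 * (`|t j| * cabs u).
  move=> jN; rewrite -normc_real -ComplexField.Normc.normcM.
  apply: cexp_sub1_bounds; rewrite ?Re_realM ?Im_realM normrM.
    by apply: le_trans hR; rewrite ler_wpM2r // tN.
  by apply: le_trans hI; rewrite ler_wpM2r // tN.
have nD j : cabs (D j) = cabs (b j) * expR (t j * complex.Re w) * cabs (cexp ((t j)%:C * u) - 1).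
  by rewrite /D !ComplexField.Normc.normcM normc_cexp Re_realM.
have t0 : t 0%N = m%:R by rewrite /t subr0.
have D0 : 4 / 5 * (M * cabs u) <= cabs (D 0%N) <= 4 / 3 * (M * cabs u).
  have /andP[l1 l2] := bd 0%N isT; rewrite nD t0 in l1 l2 *.
  rewrite [`|m%:R|]ger0_norm // in l1 l2.
  have c0 : 0 <= cabs (b 0%N) * expR (m%:R * complex.Re w) by rewrite mulr_ge0 ?normc_ge0 ?expR_ge0.
  apply/andP; split.
    apply: le_trans (ler_wpM2l c0 l1); rewrite /M le_eqVlt; apply/orP; left; apply/eqP; ring.
  apply: (le_trans (ler_wpM2l c0 l2)); rewrite /M le_eqVlt; apply/orP; left; apply/eqP; ring.
have K0 : 0 <= K by apply: le_trans (hK 0%N isT); exact: normc_ge0.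
have Dj (i : 'I_N) : cabs (D i.+1) <=
    4 / 3 * K * m%:R * expR (m%:R * complex.Re w) * cabs u * (i.+1%:R * q ^+ i.+1).
  rewrite nD; have /andP[_ l2] := bd i.+1 (ltn_ord i).
  have tj : `|t i.+1| <= m%:R * i.+1%:R.
    have m1 : 1 <= m%:R :> R by rewrite ler1n.
    have i1 : 1 <= i.+1%:R :> R by rewrite ler1n.
    by rewrite /t ler_norml; move: (m%:R : R) (i.+1%:R : R) m1 i1 => mm ii m1 i1; nra.
  have ee : expR (t i.+1 * complex.Re w) = expR (m%:R * complex.Re w) * q ^+ i.+1.
    by rewrite /q -expRM_natl -expRD /t; congr expR; ring.
  rewrite ee.
  apply: le_trans (_ : K * (expR (m%:R * complex.Re w) * q ^+ i.+1) * (4 / 3 * (m%:R * i.+1%:R * cabs u)) <= _).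
    apply: ler_pM; rewrite ?normc_ge0 //.
    - by rewrite !mulr_ge0 ?normc_ge0 ?expR_ge0 ?exprn_ge0 ?ltW.
    - by rewrite ler_wpM2r ?mulr_ge0 ?expR_ge0 ?exprn_ge0 ?hK // ltW.
    - by apply: (le_trans l2); rewrite ler_wpM2l // ler_wpM2r ?normc_ge0.
  rewrite le_eqVlt; apply/orP; left; apply/eqP; ring.
set E := \sum_(i < N) D i.+1.
(* The constant is 4/3 * 32/31 * 1/8 = 16/93 < 9/50. The final constants are then 4/5 - 9/50 = 31/50
   and 4/3 + 9/50 < 38/25. *)
have hE : cabs E <= 9 / 50 * (M * cabs u).
  apply: (le_trans (le_normc_sum _ _ _)).
  apply: le_trans (_ : \sum_(i < N) 4 / 3 * K * m%:R * expR (m%:R * complex.Re w) * cabs u * (i.+1%:R * q ^+ i.+1) <= _).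
    by apply: ler_sum => i _; exact: Dj.
  rewrite -mulr_sumr.
  apply: le_trans (_ : 4 / 3 * K * m%:R * expR (m%:R * complex.Re w) * cabs u * (32 / 31 * q) <= _).
    rewrite ler_wpM2l //; first by rewrite !mulr_ge0 ?normc_ge0 ?expR_ge0.
    by apply: sum_natr_expr_le; rewrite q64 ltW.
  have -> : 4 / 3 * K * m%:R * expR (m%:R * complex.Re w) * cabs u * (32 / 31 * q) =
     128 / 93 * (K * q) * (m%:R * expR (m%:R * complex.Re w) * cabs u) by field.
  have -> : 9 / 50 * (M * cabs u) = (9 / 50 * cabs (b 0%N)) * (m%:R * expR (m%:R * complex.Re w) * cabs u).
    by rewrite /M; ring.
  rewrite ler_wpM2r ?mulr_ge0 ?normc_ge0 ?expR_ge0 //.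
  have := normc_ge0 (b 0%N); lra.
rewrite eD big_ord_recl /=.
have -> : \sum_(i < N) D (bump 0 i) = E by [].
have a1 := le_normcD (D 0%N) E.
have a2 : cabs (D 0%N) <= cabs (D 0%N + E) + cabs E.
  by have := le_normcD (D 0%N + E) (- E); rewrite normcN addrK.
have M0 : 0 <= M * cabs u by rewrite !mulr_ge0 ?normc_ge0 ?expR_ge0.
move: D0 hE a1 a2 M0; rewrite -!(mulrA _ M); move: (M * cabs u) (cabs (D _)) (cabs E) (cabs (_ + _)).
by move=> A B C G /andP[]; lra.
Qed.

(** Passing from Re w to the edge x costs at most e^(m r) <= 4/3, and |z - w| <= 10/7 r, so the
    upper constant is 38/25 * 4/3 * 10/7 < 3. *)
Lemma expsum_expanding (N m : nat) b (K x r mu : R) z w :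
  (0 < m <= N)%N -> N%:R * r <= 4^-1 ->
  (forall j, (j <= N)%N -> cabs (b j) <= K) ->
  64 <= expR x -> 8 * K <= cabs (b 0%N) * expR x ->
  x <= complex.Re z <= x + r -> x <= complex.Re w <= x + r ->
  `|complex.Im z - complex.Im w| <= r ->
  mu = cabs (b 0%N) * m%:R * expR (m%:R * x) ->
  31 / 50 * mu * cabs (z - w) <= cabs (expsum N b m z - expsum N b m w) <= 3 * mu * r.
Proof.
move=> mN hr hK h64 h8 /andP[z1 z2] /andP[w1 w2] hI emu.
have r0 : 0 <= r by apply: le_trans hI.
have exw : expR x <= expR (complex.Re w) by rewrite ler_expR.
have hR : `|complex.Re (z - w)| <= r.
  by case: z w z1 z2 w1 w2 {hI exw} => [a c] [d e] /=; rewrite ler_norml; lra.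
have hI' : `|complex.Im (z - w)| <= r by case: z w hI {z1 z2 w1 w2 exw hR} => [a c] [d e].
have cz : cabs (z - w) <= 10 / 7 * r by exact: normc_le_max.
have A1 : N%:R * `|complex.Re (z - w)| <= 4^-1 by apply: le_trans hr; rewrite ler_wpM2l.
have A2 : N%:R * `|complex.Im (z - w)| <= 4^-1 by apply: le_trans hr; rewrite ler_wpM2l.
have A3 : 64 <= expR (complex.Re w) by exact: le_trans exw.
have A4 : 8 * K <= cabs (b 0%N) * expR (complex.Re w).
  by apply: (le_trans h8); rewrite ler_wpM2l ?normc_ge0.
have /andP[l1 l2] := expsum_bounds mN A1 A2 hK A3 A4.
have N0 : 0 <= m%:R :> R by [].
have e1 : expR (m%:R * x) <= expR (m%:R * complex.Re w) by rewrite ler_expR ler_wpM2l.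
have e2 : expR (m%:R * complex.Re w) <= 4 / 3 * expR (m%:R * x).
  have -> : m%:R * complex.Re w = m%:R * (complex.Re w - x) + m%:R * x by ring.
  rewrite expRD ler_wpM2r ?expR_ge0 //.
  have le4 : m%:R * (complex.Re w - x) <= 4^-1.
    apply: le_trans hr; apply: ler_pM => //; [lra| |lra].
    by rewrite ler_nat; case/andP: mN.
  apply: (le_trans (expR_le_inv _)); first lra.
  rewrite -[leRHS]invrK lef_pV2 ?posrE ?invr_gt0; lra.
set c := cabs (b 0%N) * m%:R in emu l1 l2 *.
have c0 : 0 <= c by rewrite mulr_ge0 ?normc_ge0.
have mu0 : 0 <= mu by rewrite emu mulr_ge0 ?expR_ge0.
have f1 : mu <= c * expR (m%:R * complex.Re w) by rewrite emu ler_wpM2l.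
have f2 : c * expR (m%:R * complex.Re w) <= 4 / 3 * mu by rewrite emu mulrCA ler_wpM2l.
apply/andP; split.
  by apply: le_trans l1; rewrite ler_wpM2r ?normc_ge0 //; lra.
apply: (le_trans l2).
apply: le_trans (_ : 38 / 25 * (4 / 3 * mu) * (10 / 7 * r) <= _).
  have ce0 : 0 <= c * expR (m%:R * complex.Re w) by rewrite mulr_ge0 ?expR_ge0.
  by apply: ler_pM; rewrite ?normc_ge0 //; lra.
by have := mulr_ge0 mu0 r0; nra.
Qed.

End exponential_sums.

(** * The function P(e^z)/e^z as an exponential sum in each half-plane *)

Section exponential_quotient.
Variable R : realType.
Implicit Types (P : {poly R[i]}) (z w : R[i]) (p q : R * R).

Definition planar (f : R[i] -> R[i]) p : R * R :=
  (complex.Re (f (p.1 +i* p.2)), complex.Im (f (p.1 +i* p.2))).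

Lemma expquotE (N : nat) P z : size P = N.+1 ->
  expquot P z = \sum_(j < N.+1) P`_j * cexp ((j%:R - 1 : R)%:C * z).
Proof.
move=> hP; rewrite /expquot horner_coef hP mulr_suml; apply: eq_bigr => j _.
rewrite -mulrA; congr (_ * _).
by rewrite rmorphB rmorph1 rmorph_nat mulrBl mul1r cexpD cexpMn cexpN.
Qed.

(** To the right a_N e^((N-1)z) dominates, so the coefficients are reversed to put it first. *)
Lemma expquot_right (N : nat) P z : size P = N.+1 -> (0 < N)%N ->
  expquot P z = expsum N (fun j => P`_(N - j)) N.-1 z.
Proof.
move=> hP N0; rewrite (expquotE _ hP) /expsum (reindex_inj rev_ord_inj) /=.
apply: eq_bigr => j _; rewrite subSS.
have jN : (j <= N)%N by rewrite -ltnS.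
suff -> : (N - j)%:R - 1 = N.-1%:R - j%:R :> R by [].
by rewrite natrB // -subn1 natrB //; ring.
Qed.

(** To the left a_0 e^(-z) dominates; as a function of [- z] it is the term of exponent m = 1. *)
Lemma expquot_left (N : nat) P z : size P = N.+1 ->
  expquot P z = expsum N (fun j => P`_j) 1 (- z).
Proof.
move=> hP; rewrite (expquotE _ hP) /expsum; apply: eq_bigr => j _.
by rewrite -[in RHS]opprB rmorphN mulrNN.
Qed.

Lemma le_cstK (N : nat) P j : (j <= N)%N -> cabs P`_j <= cstK N P.
Proof.
by move=> jN; have := @le_bigmax _ _ _ 0 (fun i : 'I_N.+1 => cabs P`_i) (Ordinal (jN : (j < N.+1)%N)).
Qed.

Lemma cstK_ge0 (N : nat) P : 0 <= cstK N P.
Proof. exact: le_trans (normc_ge0 _) (le_cstK P (leq0n N)). Qed.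

(** All exponents satisfy |j - 1| <= N. This crude global bound serves to control the growth of the
    maximum modulus. *)
Lemma normc_expquot_le (N : nat) P z : size P = N.+1 -> (0 < N)%N ->
  cabs (expquot P z) <= N.+1%:R * cstK N P * expR (N%:R * cabs z).
Proof.
move=> hP N0; rewrite (expquotE _ hP).
apply: (le_trans (le_normc_sum _ _ _)).
apply: le_trans (_ : \sum_(j < N.+1) cstK N P * expR (N%:R * cabs z) <= _).
  apply: ler_sum => j _; rewrite ComplexField.Normc.normcM normc_cexp Re_realM.
  have jN : (j <= N)%N by rewrite -ltnS.
  apply: ler_pM; rewrite ?normc_ge0 ?expR_ge0 ?le_cstK //.
  rewrite ler_expR; apply: (le_trans (ler_norm _)); rewrite normrM.
  apply: ler_pM => //; last exact: normc_geRe.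
  have j1 : j%:R <= N%:R :> R by rewrite ler_nat.
  have N1 : 1 <= N%:R :> R by rewrite ler1n.
  by rewrite ler_norml; have := ler0n R j; lra.
by rewrite sumr_const card_ord -mulrA [leRHS]mulr_natl.
Qed.

(** The reflection [sg] treats both half-planes at once, and [mu] dominates K_0 e^x because m >= 1
    and x >= 0. Coordinates at most d give modulus at most 10/7 d, and 10/7 divided by 31/50 is
    below 3. The coordinatewise form suits coverings by squares. *)
Lemma expquot_expanding (N : nat) P (x r : R) (s : bool) :
  (2 <= N)%N -> size P = N.+1 -> 64 <= expR x ->
  8 * cstK N P <= cstK0 N P * expR x -> N%:R * r <= 4^-1 ->
  exists2 mu, cstK0 N P * expR x <= mu &
    forall p q, x <= (-1) ^+ s * p.1 <= x + r -> x <= (-1) ^+ s * q.1 <= x + r ->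
      `|p.2 - q.2| <= r ->
      `|(planar (expquot P) p).2 - (planar (expquot P) q).2| <= 3 * mu * r /\
      forall d, 0 <= d ->
        `|(planar (expquot P) p).1 - (planar (expquot P) q).1| <= d ->
        `|(planar (expquot P) p).2 - (planar (expquot P) q).2| <= d ->
        mu * `|p.1 - q.1| <= 3 * d /\ mu * `|p.2 - q.2| <= 3 * d.
Proof.
move=> hN hP h64 h8 hr.
have N0 : (0 < N)%N by exact: leq_trans hN.
pose m := if s then 1%N else N.-1.
pose b j := if s then P`_j else P`_(N - j).
have N1 : (0 < N.-1)%N by rewrite -ltnS prednK.
have mN : (0 < m <= N)%N by rewrite /m; case: (s); rewrite ?N0 ?N1 ?leq_pred.
have bK j : (j <= N)%N -> cabs (b j) <= cstK N P.
  by move=> jN; rewrite /b; case: (s); apply: le_cstK => //; exact: leq_subr.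
have K0b : cstK0 N P <= cabs (b 0%N).
  by rewrite /cstK0 /b; case: (s); rewrite ?subn0 ge_min lexx ?orbT.
have x0 : 0 <= x by rewrite leNgt -expR_lt1; apply/negP; lra.
have b8 : 8 * cstK N P <= cabs (b 0%N) * expR x.
  by apply: (le_trans h8); rewrite ler_wpM2r ?expR_ge0.
pose sg z : R[i] := if s then - z else z.
have sgB z w : cabs (sg z - sg w) = cabs (z - w).
  by rewrite /sg; case: (s) => //; rewrite -opprD normcN.
have fE z : expquot P z = expsum N b m (sg z).
  by rewrite /b /m /sg; case: (s); [exact: expquot_left|exact: expquot_right].
have sgR p : complex.Re (sg (p.1 +i* p.2)) = (-1) ^+ s * p.1.
  by rewrite /sg; case: (s); rewrite /= ?expr1 ?mulN1r ?expr0 ?mul1r.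
have m1 : 1 <= m%:R :> R by rewrite ler1n; case/andP: mN.
exists (cabs (b 0%N) * m%:R * expR (m%:R * x)).
  apply: ler_pM; rewrite ?expR_ge0 //.
  - by rewrite /cstK0 le_min !normc_ge0.
  - by apply: (le_trans K0b); rewrite ler_peMr ?normc_ge0.
  - by rewrite ler_expR ler_peMl.
move=> p q hp hq hpq.
have hI : `|complex.Im (sg (p.1 +i* p.2)) - complex.Im (sg (q.1 +i* q.2))| <= r.
  by rewrite /sg; case: (s) => //=; rewrite -opprD normrN.
rewrite -sgR in hp; rewrite -sgR in hq.
have := expsum_expanding mN hr bK h64 b8 hp hq hI erefl.
rewrite -!fE sgB.
have mu0 : 0 <= cabs (b 0%N) * m%:R * expR (m%:R * x).
  by rewrite !mulr_ge0 ?normc_ge0 ?expR_ge0.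
move: (cabs (b 0%N) * m%:R * expR (m%:R * x)) mu0 => mu mu0 /andP[l1 l2].
have hz : `|p.1 - q.1| <= cabs (p.1 +i* p.2 - (q.1 +i* q.2)).
  exact: normc_geRe (p.1 +i* p.2 - (q.1 +i* q.2)).
have hz' : `|p.2 - q.2| <= cabs (p.1 +i* p.2 - (q.1 +i* q.2)).
  exact: normc_geIm (p.1 +i* p.2 - (q.1 +i* q.2)).
have hf := normc_geIm (expquot P (p.1 +i* p.2) - expquot P (q.1 +i* q.2)).
have hf' := @normc_le_max R (expquot P (p.1 +i* p.2) - expquot P (q.1 +i* q.2)).
move: hz hz' l1; move: (cabs (p.1 +i* p.2 - _)) => U hz hz' l1.
rewrite /planar /=.
case: (expquot P (p.1 +i* p.2)) (expquot P (q.1 +i* q.2)) l1 l2 hf hf' => [a c] [a' c'] l1 l2 hf hf'.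
split; first exact: le_trans hf l2.
move=> d d0 d1 d2; have := hf' d d0 d1 d2; move: l1.
move: (cabs (_ - _)) => V l1 l3.
by split; nra.
Qed.

End exponential_quotient.

(** * Planar Lebesgue measure *)

Section planar_measure.
Variable R : realType.
Let T2 := (measurableTypeR R * measurableTypeR R)%type.
Implicit Types (p q : R * R) (V S : set (R * R)) (n : nat) (h : R).

Local Notation leb2 := (@lebesgue_measure R \x @lebesgue_measure R)%E.

Definition box (a b c d : R) : set (R * R) := `[a, b]%classic `*` `[c, d]%classic.

Lemma leb2_bigcup_le (F : nat -> set (R * R)) (c : \bar R) :
  (forall n, measurable (F n : set T2)) -> nondecreasing_seq F ->
  (forall n, leb2 (F n) <= c)%E -> (leb2 (\bigcup_n F n) <= c)%E.
Proof.
move=> mF ndF Fc; apply: (@cvge_le _ \oo _ _ (leb2 \o F)).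
  by apply: nearW => n; exact: Fc.
by apply: nondecreasing_cvg_mu => //; exact: bigcup_measurable.
Qed.

Lemma measurable_box a b c d : measurable (box a b c d : set T2).
Proof. by apply: measurableX; exact: measurable_itv. Qed.

Lemma leb2_itvX (i j : interval R) :
  leb2 ([set` i] `*` [set` j]) = (lebesgue_measure [set` i] * lebesgue_measure [set` j])%E.
Proof. by apply: product_measure1E; exact: measurable_itv. Qed.

Lemma leb2_box a b c d : a <= b -> c <= d ->
  leb2 (box a b c d) = ((b - a) * (d - c))%:E.
Proof.
move=> ab cd; rewrite /box leb2_itvX !lebesgue_measure_itv /= !lte_fin.
have [ab'|ab'] := ltP a b; have [cd'|cd'] := ltP c d; rewrite -?EFinB -?EFinM ?mul0e ?mule0 //.
- by rewrite (@le_anti _ _ c d) ?subrr ?mulr0 // cd cd'.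
- by rewrite (@le_anti _ _ a b) ?subrr ?mul0r // ab ab'.
- by rewrite (@le_anti _ _ a b) ?subrr ?mul0r // ab ab'.
Qed.

Definition cell h (ij : int * int) : set (R * R) :=
  `[ij.1%:~R * h, (ij.1 + 1)%:~R * h[%classic `*` `[ij.2%:~R * h, (ij.2 + 1)%:~R * h[%classic.

Lemma cellP h ij p : 0 < h ->
  cell h ij p <-> (ij = (Num.floor (p.1 / h), Num.floor (p.2 / h))).
Proof.
move=> h0; have E (i : int) (y : R) : (i%:~R * h <= y < (i + 1)%:~R * h) = (i == Num.floor (y / h)).
  rewrite -ler_pdivlMr // -ltr_pdivrMr //.
  apply/idP/eqP => [H|->]; last exact: floor_itv.
  by apply/esym/floor_def.
split; first by case: ij => i j [] /=; rewrite !in_itv /= !E => /eqP -> /eqP ->.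
by move=> ->; split; rewrite /= in_itv /= E.
Qed.

Lemma measurable_cell h ij : measurable (cell h ij : set T2).
Proof. by apply: measurableX; exact: measurable_itv. Qed.

Lemma leb2_cell h ij : 0 < h -> leb2 (cell h ij) = (h ^+ 2)%:E.
Proof.
move=> h0; rewrite /cell leb2_itvX !lebesgue_measure_itv /= !lte_fin !ltr_pM2r //.
rewrite !ltr_int !ltrDl ltr01.
by rewrite -!EFinB -EFinM; congr EFin; rewrite !intrD; ring.
Qed.

(* The squares of the grid of mesh [h], indexed by [nat] so that countable
   additivity applies. *)
Definition ncell h (k : nat) : set (R * R) :=
  [set p | pickle (Num.floor (p.1 / h), Num.floor (p.2 / h)) = k].

Lemma ncellE h k : 0 < h ->
  ncell h k = if pickle_inv k is Some ij then cell h ij else set0.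
Proof.
move=> h0; apply/seteqP; split => p.
  by rewrite /ncell /= => <-; rewrite pickleK_inv; apply/cellP.
have := @pickle_invK (int * int)%type k; rewrite /ncell /=.
by case: pickle_inv => [ij|] //= <- /cellP ->.
Qed.

Lemma measurable_ncell h k : 0 < h -> measurable (ncell h k : set T2).
Proof.
move=> /ncellE ->.
by case: pickle_inv => [ij|]; [exact: measurable_cell|exact: measurable0].
Qed.

Lemma trivIset_ncell h (D : set nat) : trivIset D (ncell h).
Proof. by move=> k l _ _ [p []]; rewrite /ncell /= => -> ->. Qed.

Lemma ncell_diam h k p q : 0 < h -> ncell h k p -> ncell h k q ->
  `|p.1 - q.1| <= h /\ `|p.2 - q.2| <= h.
Proof.
move=> h0; rewrite (ncellE _ h0); case: pickle_inv => [[i j]|] //.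
case=> /=; rewrite !in_itv /= => /andP[p1 p2] /andP[p3 p4].
case=> /=; rewrite !in_itv /= => /andP[q1 q2] /andP[q3 q4].
move: p1 p2 p3 p4 q1 q2 q3 q4; rewrite !intrD !mulrDl !mul1r => *.
by split; rewrite ler_norml; lra.
Qed.

Definition gridpart h V := \bigcup_(k in [set k | ncell h k `<=` V]) ncell h k.

Lemma gridpartP h V p :
  gridpart h V p <-> ncell h (pickle (Num.floor (p.1 / h), Num.floor (p.2 / h))) `<=` V.
Proof.
split; first by move=> [k kV pk]; rewrite /ncell /= in pk; rewrite pk.
by move=> H; exists (pickle (Num.floor (p.1 / h), Num.floor (p.2 / h))).
Qed.

Lemma sub_gridpart h V : gridpart h V `<=` V.
Proof. by move=> p [k kV pk]; exact: kV. Qed.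

Lemma measurable_gridpart h V : 0 < h -> measurable (gridpart h V : set T2).
Proof. by move=> h0; apply: bigcup_measurable => k _; exact: measurable_ncell. Qed.

(** The value floor(2u) determines floor(u): if i and j denote floor(u) and floor(2u), then j is 2i
    or 2i + 1. *)
Lemma ncell_half h p : 0 < h ->
  ncell (h / 2) (pickle (Num.floor (p.1 / (h / 2)), Num.floor (p.2 / (h / 2)))) `<=` 
  ncell h (pickle (Num.floor (p.1 / h), Num.floor (p.2 / h))).
Proof.
move=> h0; have E (x y : R) :
    Num.floor (y / (h / 2)) = Num.floor (x / (h / 2)) -> Num.floor (y / h) = Num.floor (x / h).
  have e z : z / (h / 2) = 2 * (z / h) by field; rewrite gt_eqF.
  rewrite !e => H; apply: floor_def.
  have := floor_itv (x / h); have := floor_itv (2 * (x / h)); have := floor_itv (2 * (y / h)).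
  rewrite H; 
  move: (Num.floor (x / h)) (Num.floor (2 * (x / h))) => i j; move: (x / h) (y / h) => u v.
  move=> /andP[a1 a2] /andP[a3 a4] /andP[a5 a6].
  have l1 : 2 * i <= j by rewrite -ltzD1 -(ltr_int R); apply: le_lt_trans a4; rewrite intrM; lra.
  have l2 : j + 1 <= 2 * (i + 1) by rewrite -ltzD1 ltrD2r -(ltr_int R); apply: le_lt_trans a3 _; rewrite intrM; lra.
  rewrite -(ler_int R) intrM in l1; rewrite -(ler_int R) intrM in l2.
  by apply/andP; split; lra.
move=> q; rewrite /ncell /= => /(pcan_inj (@pickleK _)) [e1 e2].
by rewrite (E _ _ e1) (E _ _ e2).
Qed.

Definition dyad n : R := 2^-1 ^+ n.

Lemma dyad_gt0 n : 0 < dyad n. Proof. by rewrite exprn_gt0. Qed.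

Lemma gridpart_nd V : nondecreasing_seq (fun n => gridpart (dyad n) V).
Proof.
apply/nondecreasing_seqP => n; apply/subsetPset => p /gridpartP pV; apply/gridpartP.
apply: subset_trans pV; rewrite /dyad exprSr; apply: ncell_half; exact: dyad_gt0.
Qed.

(** Balls of [R * R] are squares for the max norm, so a grid square through p of mesh less than the
    radius stays inside the ball. *)
Lemma open_gridpart V : open V -> V = \bigcup_n gridpart (dyad n) V.
Proof.
move=> oV; apply/seteqP; split => [p Vp|p [n _]]; last exact: sub_gridpart.
have /nbhs_ballP[e /= e0 be] : nbhs p V by exact: open_nbhs_nbhs.
have [n ne] : exists n, dyad n < e.
  have : (fun n => dyad n) @ \oo --> (0 : R).
    by apply: cvg_expr; rewrite ger0_norm //; lra.
  move=> /cvgrPdist_lt /(_ e e0) [n _ /(_ n (leqnn n))] /=.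
  by rewrite sub0r normrN ger0_norm ?ltW ?dyad_gt0 // => ?; exists n.
exists n => //; apply/gridpartP => q nq; apply: be.
have [d1 d2] := ncell_diam (dyad_gt0 n) (erefl : ncell (dyad n) _ p) nq.
by split; apply: le_lt_trans ne.
Qed.

(** This links the product topology with the product sigma-algebra: an open set is a countable union
    of grid squares. *)
Lemma open_measurable2 V : open V -> measurable (V : set T2).
Proof.
move=> /open_gridpart ->; apply: bigcup_measurable => n _.
by apply: measurable_gridpart; exact: dyad_gt0.
Qed.

Lemma continuous_measurable2 (g : R * R -> R) : continuous g ->
  measurable_fun setT (g : T2 -> measurableTypeR R).
Proof.
move=> cg; apply: (measurability _ (measurable_realfun.RGenOInfty.measurableE R)).
move=> _ [_ [x ->] <-]; rewrite setTI; apply: open_measurable2.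
by apply: open_comp; [move=> p _; exact: cg|exact: rray_open].
Qed.

Lemma continuous_measurable_planar (G : R * R -> R * R) :
  continuous (fun p => (G p).1) -> continuous (fun p => (G p).2) ->
  measurable_fun setT (G : T2 -> T2).
Proof.
by move=> c1 c2; apply/measurable_fun_pairP; split; exact: continuous_measurable2.
Qed.

(* Cover [V] by the dyadic squares it contains: the preimage of a square of
   side [h] lies in a box of side [6 h / mu]. *)
Lemma expanding_preimage_le (G : R * R -> R * R) S V (mu : R) :
  0 < mu -> measurable_fun setT (G : T2 -> T2) -> measurable (S : set T2) -> open V ->
  (forall p q d, S p -> S q -> 0 <= d -> `|(G p).1 - (G q).1| <= d ->
     `|(G p).2 - (G q).2| <= d -> mu * `|p.1 - q.1| <= 3 * d /\ mu * `|p.2 - q.2| <= 3 * d) ->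
  (leb2 (S `&` G @^-1` V) <= (36 / mu ^+ 2)%:E * leb2 V)%E.
Proof.
move=> mu0 mG mS oV hG.
have mpre (A : set (R * R)) : measurable (A : set T2) -> measurable (S `&` G @^-1` A : set T2).
  by move=> mA; apply: measurableI => //; rewrite -[X in measurable X]setTI; exact: mG.
have cell_le h k : 0 < h ->
    (leb2 (S `&` G @^-1` (ncell h k)) <= (36 / mu ^+ 2)%:E * leb2 (ncell h k))%E.
  move=> h0; have [->|/set0P[p [Sp Gp]]] := eqVneq (S `&` G @^-1` (ncell h k)) set0.
    by rewrite measure0 mule_ge0 // lee_fin divr_ge0 // exprn_ge0 // ltW.
  have -> : leb2 (ncell h k) = (h ^+ 2)%:E.
    by move: Gp; rewrite /= (ncellE _ h0); case: pickle_inv => [ij|] // _; rewrite leb2_cell.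
  (* Image points in one square differ by at most h in each coordinate, so the hypothesis with d = h
     keeps the preimage within [l] of [p]. The box has area (2l)^2 = 36 h^2 / mu^2. *)
  pose l := 3 * h / mu.
  have l0 : 0 <= l by rewrite /l divr_ge0 ?mulr_ge0 // ltW.
  apply: (@le_trans _ _ (leb2 (box (p.1 - l) (p.1 + l) (p.2 - l) (p.2 + l)))).
    apply: le_measure; rewrite ?inE; [by apply: mpre; exact: measurable_ncell|exact: measurable_box|].
    move=> q [Sq Gq]; have [d1 d2] := ncell_diam h0 Gp Gq.
    have [] := hG p q h Sp Sq (ltW h0) d1 d2.
    rewrite ![mu * _]mulrC -!ler_pdivlMr // !ler_norml -/l => e1 e2.
    by split; rewrite /= in_itv /=; lra.
  rewrite leb2_box; [|lra|lra].
  rewrite -EFinM lee_fin /l le_eqVlt; apply/orP; left; apply/eqP; field.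
  by rewrite gt_eqF.
have part_le n : (leb2 (S `&` G @^-1` (gridpart (dyad n) V)) <= (36 / mu ^+ 2)%:E * leb2 V)%E.
  have h0 := dyad_gt0 n.
  apply: (@le_trans _ _ ((36 / mu ^+ 2)%:E * leb2 (gridpart (dyad n) V))%E); last first.
    rewrite lee_wpmul2l //; first by rewrite lee_fin divr_ge0 // exprn_ge0 // ltW.
    apply: le_measure; rewrite ?inE; [exact: measurable_gridpart|exact: open_measurable2|exact: sub_gridpart].
  (* Countable additivity over the disjoint squares, applied on both sides, sums the bounds for
     single squares. *)
  rewrite /gridpart preimage_bigcup setI_bigcupr.
  rewrite measure_bigcup; last 2 first.
  - by move=> k _; apply: mpre; exact: measurable_ncell.
  - by move=> k l _ _ [p [[_ +] [_ +]]]; rewrite /ncell /= => -> ->.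
  rewrite measure_bigcup; last 2 first.
  - by move=> k _; exact: measurable_ncell.
  - exact: trivIset_ncell.
  rewrite -nneseriesZl //; apply: lee_nneseries => // k _.
  exact: cell_le.
rewrite {1}(open_gridpart oV) preimage_bigcup setI_bigcupr.
apply: leb2_bigcup_le.
- by move=> n; apply: mpre; apply: measurable_gridpart; exact: dyad_gt0.
- move=> n m nm; apply/subsetPset => p [Sp Gp]; split => //.
  by have /subsetPset := gridpart_nd V nm; apply.
- exact: part_le.
Qed.

End planar_measure.

(** * Density of slow points *)

Lemma continuous_pair_fun {T U V : topologicalType} (G : T -> U * V) :
  continuous (fun p => (G p).1) -> continuous (fun p => (G p).2) -> continuous G.
Proof.
move=> c1 c2 p A [[B C] [/= pB pC]] BCA; have := c1 p B pB; have := c2 p C pC.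
rewrite /= !nbhs_simpl => h2 h1.
have h : nbhs p ((fun p => (G p).1) @^-1` B `&` (fun p => (G p).2) @^-1` C).
  exact: filterI.
apply: (@filterS _ (nbhs p) _ _ _ _ h) => q [hB hC]; apply: BCA.
by split.
Qed.

Lemma continuous_comp_fun {T U W : topologicalType} (f : U -> W) (g : T -> U) :
  continuous f -> continuous g -> continuous (fun x => f (g x)).
Proof. by move=> cf cg x; exact: (continuous_comp (cg x) (cf _)). Qed.

Lemma nneseries_geometric {R : realType} (a q : R) : 0 <= q < 1 ->
  (\sum_(k <oo) (a * q ^+ k)%:E = (a / (1 - q))%:E)%E.
Proof.
move=> /andP[q0 q1]; apply/cvg_lim => //.
have -> : (fun n => \sum_(0 <= k < n) (a * q ^+ k)%:E)%E = EFin \o series (geometric a q).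
  by apply/funext => n; rewrite /series /= sumEFin.
by apply: cvg_EFin; [exact: nearW|apply: cvg_geometric_series; rewrite ger0_norm].
Qed.

Section escaping_density.
Variable R : realType.
Let T2 := (measurableTypeR R * measurableTypeR R)%type.
Implicit Types (p q : R * R) (E : set (R * R)) (s : bool) (x y h r D : R).

Local Notation leb2 := (@lebesgue_measure R \x @lebesgue_measure R)%E.

(* The boolean [s] selects the left ([s = true]) or right half-plane, so that
   [(-1) ^+ s * p.1] plays the role of |Re p|. *)
Definition sbox s x y r : set (R * R) :=
  if s then box (- (x + r)) (- x) y (y + r) else box x (x + r) y (y + r).

Definition halfstrip s x y h : set (R * R) :=
  (if s then `]-oo, (- x)]%classic else `[x, +oo[%classic) `*` `[y, y + h]%classic.

Lemma sboxP s x y r p :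
  sbox s x y r p <-> x <= (-1) ^+ s * p.1 <= x + r /\ y <= p.2 <= y + r.
Proof.
rewrite /sbox /box; case: s; rewrite ?expr1 ?mulN1r ?expr0 ?mul1r /= !in_itv //=.
by split=> -[/andP[h1 h2] h3]; split => //; apply/andP; split; lra.
Qed.

Lemma halfstripP s x y h p :
  halfstrip s x y h p <-> x <= (-1) ^+ s * p.1 /\ y <= p.2 <= y + h.
Proof.
rewrite /halfstrip; case: s; rewrite ?expr1 ?mulN1r ?expr0 ?mul1r /= !in_itv /= ?andbT //.
by split=> -[h1 h2]; split => //; lra.
Qed.

Lemma measurable_sbox s x y r : measurable (sbox s x y r : set T2).
Proof. by rewrite /sbox; case: s; exact: measurable_box. Qed.

Lemma measurable_halfstrip s x y h : measurable (halfstrip s x y h : set T2).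
Proof. by rewrite /halfstrip; case: s; apply: measurableX; exact: measurable_itv. Qed.

(** Uniformity in the side [s] and the height [y] matters for the induction, where the image of a
    square lies at an uncontrolled height. *)
Definition density_le r D x0 E := forall s x y, x0 <= x ->
  (leb2 (sbox s x y r `&` E) <= (D * expR (- (x / 2)) * r ^+ 2)%:E)%E.

(** The half-strip is tiled by columns of squares of side r. Column k has total height at most h +
    r, and its density carries the factor q^k with q = e^(-r/2); the geometric series gives 1/(1 -
    q). *)
Lemma leb2_halfstrip_le r D x0 E s x y h : 0 < r -> 0 <= D -> 0 <= h ->
  measurable (E : set T2) -> density_le r D x0 E -> x0 <= x ->
  (leb2 (halfstrip s x y h `&` E) <=
    ((h + r) * D * expR (- (x / 2)) * (r / (1 - expR (- (r / 2)))))%:E)%E.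
Proof.
move=> r0 D0 h0 mE dE xx.
(* The extra square covers the remainder when r does not divide h, so that h <= M r <= h + r. It
   also leaves room for the row index floor(h/r) at the top edge. *)
pose M := (Num.truncn (h / r)).+1.
have hr0 : 0 <= h / r by rewrite divr_ge0 // ltW.
have /andP[M1 M2] := truncn_itv hr0.
have M1' : M%:R * r <= h + r.
  by rewrite -natr1 mulrDl mul1r lerD2r -ler_pdivlMr.
have M2' : h <= M%:R * r by rewrite -ler_pdivrMr // ltW.
set q := expR (- (r / 2)).
have q1 : 0 <= q < 1 by rewrite expR_ge0 /q expR_lt1 oppr_lt0 divr_gt0.
pose C (k : nat) : set (R * R) :=
  \big[setU/set0]_(i < M) (sbox s (x + k%:R * r) (y + i%:R * r) r `&` E).
have mC k : measurable (C k : set T2).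
  by apply: bigsetU_measurable => i _; apply: measurableI => //; exact: measurable_sbox.
have Ck k : (leb2 (C k) <= ((h + r) * D * expR (- (x / 2)) * r * q ^+ k)%:E)%E.
  apply: (@le_trans _ _ (\sum_(i < M) (D * expR (- (x / 2)) * q ^+ k * r ^+ 2)%:E)%E).
    apply: le_trans (_ : \sum_(i < M) leb2 (sbox s (x + k%:R * r) (y + i%:R * r) r `&` E) <= _)%E.
      apply: (@content_subadditive _ _ _ leb2 _
        (fun i : nat => sbox s (x + k%:R * r) (y + i%:R * r) r `&` E) M) => //.
      by move=> i _; apply: measurableI => //; exact: measurable_sbox.
    apply: lee_sum => i _; apply: (le_trans (dE _ _ _ _)).
      by rewrite ler_wpDr // mulr_ge0 // ltW.
    rewrite lee_fin le_eqVlt; apply/orP; left; apply/eqP; congr (_ * _).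
    rewrite -mulrA; congr (_ * _); rewrite /q -expRM_natl -expRD; congr expR; by field.
  rewrite sumEFin lee_fin sumr_const card_ord -[leLHS]mulr_natl.
  have -> : M%:R * (D * expR (- (x / 2)) * q ^+ k * r ^+ 2) =
    (M%:R * r) * (D * expR (- (x / 2)) * r * q ^+ k) by ring.
  have -> : (h + r) * D * expR (- (x / 2)) * r * q ^+ k =
    (h + r) * (D * expR (- (x / 2)) * r * q ^+ k) by ring.
  by rewrite ler_wpM2r // !mulr_ge0 ?expR_ge0 ?exprn_ge0 ?(ltW r0) //; case/andP: q1.
apply: (@le_trans _ _ (\sum_(k <oo) leb2 (C k))%E).
  apply: measure_sigma_subadditive => //.
    by apply: measurableI => //; exact: measurable_halfstrip.
  move=> p [/halfstripP[px /andP[py1 py2]] Ep].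
  set u := (-1) ^+ s * p.1 in px.
  have kx : 0 <= (u - x) / r by rewrite divr_ge0 ?subr_ge0 // ltW.
  have /andP[k1 k2] := truncn_itv kx.
  rewrite ler_pdivlMr // in k1; rewrite ltr_pdivrMr // -natr1 mulrDl mul1r in k2.
  exists (Num.truncn ((u - x) / r)) => //.
  rewrite /C -(bigcup_mkord M (fun i : nat => sbox s (x + _) (y + i%:R * r) r `&` E)).
  have iy : 0 <= (p.2 - y) / r by rewrite divr_ge0 ?subr_ge0 // ltW.
  have /andP[i1 i2] := truncn_itv iy.
  exists (Num.truncn ((p.2 - y) / r)).
    rewrite /= /M ltnS.
    apply: le_truncn; rewrite ler_pM2r ?invr_gt0 //; lra.
  rewrite ler_pdivlMr // in i1; rewrite ltr_pdivrMr // -natr1 mulrDl mul1r in i2.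
  by split => //; apply/sboxP; rewrite -/u; split; apply/andP; split; lra.
apply: (@le_trans _ _ (\sum_(k <oo) ((h + r) * D * expR (- (x / 2)) * r * q ^+ k)%:E)%E).
  by apply: lee_nneseries => // k _; exact: Ck.
by rewrite nneseries_geometric // lee_fin mulrA.
Qed.

Variable G : R * R -> R * R.

(** The recursion peels off the first step of the orbit, so [slow n.+1] is a condition on [p] joined
    to the preimage of [slow n] under a single [G]. The strict inequality makes these sets open. *)
Fixpoint slow n : set (R * R) :=
  if n is m.+1 then [set p | `|(G p).1| < expR (`|p.1| / 2) \/ slow m (G p)]
  else set0.

Lemma slow_sub n : slow n `<=` slow n.+1.
Proof. by elim: n => // n IH p /= [|/IH]; [left|right]. Qed.

Lemma nondecreasing_slow : nondecreasing_seq slow.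
Proof. by apply/nondecreasing_seqP => n; apply/subsetPset; exact: slow_sub. Qed.

(** If [p] is never slow then neither is [G p], so the first-step inequality propagates along the
    orbit. *)
Lemma not_slow_growth p : ~ (\bigcup_n slow n) p ->
  forall n, expR (`|(iter n G p).1| / 2) <= `|(iter n.+1 G p).1|.
Proof.
move=> + n; elim: n p => [|n IH] p hp.
  by rewrite leNgt; apply/negP => ?; apply: hp; exists 1%N => //; left.
have := IH (G p); rewrite -!iterSr; apply => -[m _ mG].
by apply: hp; exists m.+1 => //; right.
Qed.

Hypotheses (cG1 : continuous (fun p => (G p).1)) (cG2 : continuous (fun p => (G p).2)).

Lemma open_slow n : open (slow n).
Proof.
elim: n => [|n IH]; first exact: open0.
have -> : slow n.+1 = [set p | `|(G p).1| < expR (`|p.1| / 2)] `|` G @^-1` slow n by [].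
apply: openU.
  have -> : [set p | `|(G p).1| < expR (`|p.1| / 2)] =
    (fun p => expR (`|p.1| / 2) - `|(G p).1|) @^-1` [set u | 0 < u].
    by apply/seteqP; split => p /=; rewrite subr_gt0.
  apply: open_comp; last exact: open_gt.
  move=> p _; apply: cvgB; last by apply: cvg_norm; exact: cG1.
  apply: (continuous_comp_fun (f := expR) (g := fun p : R * R => `|p.1| / 2)).
    exact: continuous_expR.
  by move=> q; apply: cvgMr_tmp; apply: cvg_norm; exact: cvg_fst.
apply: open_comp => // p _.
exact: (continuous_pair_fun cG1 cG2).
Qed.

Lemma measurable_slow n : measurable (slow n : set T2).
Proof. by apply: open_measurable2; exact: open_slow. Qed.

End escaping_density.

(** Tangent line of the exponential at 3 ln 2: e^(x/2) >= 8 (1 + x/2 - 3 ln 2), with x >= 6 ln 2 and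
    ln 2 <= 1. Hence x |-> e^(x/2) raises such x by at least 1. *)
Lemma expR_half_ge {R : realType} (x : R) : 64 <= expR x -> x + 1 <= expR (x / 2).
Proof.
move=> x64.
have l2 : ln 2 <= 1 :> R by have := @le_ln1Dx R 1; rewrite -[1 + 1]/(2%:R); apply; lra.
have e2 : expR (ln 2) = 2 :> R by rewrite lnK // posrE.
have e6 : expR (6%:R * ln 2) = 64 :> R by rewrite expRM_natl e2; ring.
have x6 : 6 * ln 2 <= x by rewrite -ler_expR e6.
have -> : x / 2 = 3%:R * ln 2 + (x / 2 - 3 * ln 2) by ring.
rewrite expRD expRM_natl e2.
have := expR_ge1Dx (x / 2 - 3 * ln 2); move: (expR (x / 2 - 3 * ln 2)) => u.
lra.
Qed.

(** * Induction on the number of steps for the density of slow points *)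

Section slow_density.
Variable R : realType.
Let T2 := (measurableTypeR R * measurableTypeR R)%type.
Local Notation leb2 := (@lebesgue_measure R \x @lebesgue_measure R)%E.

(* [mu] is the modulus of the derivative of the dominant term at the end of the
   square nearer to the imaginary axis. *)
Definition strip_expanding (G : R * R -> R * R) (r x0 K : R) :=
  forall (x : R) (s : bool), x0 <= x -> exists2 mu, K * expR x <= mu &
  forall p q : R * R, x <= (-1) ^+ s * p.1 <= x + r -> x <= (-1) ^+ s * q.1 <= x + r ->
    `|p.2 - q.2| <= r ->
    `|(G p).2 - (G q).2| <= 3 * mu * r /\
    forall d, 0 <= d -> `|(G p).1 - (G q).1| <= d -> `|(G p).2 - (G q).2| <= d ->
      mu * `|p.1 - q.1| <= 3 * d /\ mu * `|p.2 - q.2| <= 3 * d.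

(** From e^(-r/2) (1 + r/2) <= 1 the quotient is at most 2 + r. *)
Lemma geometric_factor_le (r : R) : 0 < r -> r <= 8^-1 -> r / (1 - expR (- (r / 2))) <= 3.
Proof.
move=> r0 r8; have e1 : 0 < 1 - expR (- (r / 2)) by rewrite subr_gt0 expR_lt1 oppr_lt0 divr_gt0.
rewrite ler_pdivrMr //.
have h1 := expR_ge1Dx (r / 2); have h2 := expR_gt0 (- (r / 2)).
have h3 : expR (- (r / 2)) * expR (r / 2) = 1 by rewrite -expRD addNr expR0.
move: h1 h2 h3; move: (expR (- _)) (expR _) => u v h1 h2 h3.
have h4 : u * (1 + r / 2) <= 1 by rewrite -[leRHS]h3 ler_wpM2l // ltW.
have h5 : r * r <= r * 8^-1 by rewrite ler_wpM2l // ltW.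
rewrite leNgt; apply/negP => h6.
have h7 : 1 - r / 3 <= u by lra.
have h8 : 0 <= 1 + r / 2 by lra.
have := ler_wpM2r h8 h7; lra.
Qed.

(* With [t = e^(x/2)], [T <= 4/3 t] and [mu >= K t^2]: the set of slow image points
   has area at most [2T * 7 mu r + 2 * (7 mu r + r) * 3 D], and pulling back
   costs a factor [36 / mu^2]. *)
Lemma slow_density_arith (r K D t T mu : R) : 0 < r -> r <= 8^-1 -> 0 < K -> 0 < D ->
  5120 <= D * (K * r) -> 2560 <= K * r * t ->
  1 <= t -> T <= 4 / 3 * t -> K * t ^+ 2 <= mu ->
  36 / mu ^+ 2 * (2 * T * (7 * mu * r) + 2 * ((7 * mu * r + r) * D * 3)) <= D * t^-1 * r ^+ 2.
Proof.
move=> r0 r8 K0 D0 hD Kt t1 Tt mut; have t0 : 0 < t by exact: lt_le_trans t1.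
have mu0 : 0 < mu by apply: lt_le_trans mut; rewrite mulr_gt0 // exprn_gt0.
have A0 : 0 < K * r by rewrite mulr_gt0.
have m1 : K * r * t ^+ 2 <= mu * r.
  by rewrite (mulrAC K); exact: (ler_wpM2r (ltW r0) mut).
have m2 : 2560 * t <= mu * r.
  by apply: le_trans m1; rewrite expr2 mulrA; exact: (ler_wpM2r (ltW t0) Kt).
have m3 : 1 <= mu by have := ler_wpM2l (ltW mu0) r8; lra.
(* Denominators are cleared here. After division by mu r the claim reads 672 t^2 + 1728 D t <= D mu
   r, and both terms are compared with Y = D K r t^2 <= D mu r: 672/5120 + 1728/2560 < 1. *)
suff H : 36 * (2 * T * (7 * mu * r) + 2 * ((7 * mu * r + r) * D * 3)) * t <= D * r ^+ 2 * mu ^+ 2.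
  rewrite -(ler_pM2r t0) -(ler_pM2r (exprn_gt0 2 mu0)).
  have -> : 36 / mu ^+ 2 * (2 * T * (7 * mu * r) + 2 * ((7 * mu * r + r) * D * 3)) * t * mu ^+ 2 =
    36 * (2 * T * (7 * mu * r) + 2 * ((7 * mu * r + r) * D * 3)) * t by field; rewrite gt_eqF.
  have -> : D * t^-1 * r ^+ 2 * t * mu ^+ 2 = D * r ^+ 2 * mu ^+ 2 by field; rewrite gt_eqF.
  exact: H.
have mr0 : 0 < mu * r by rewrite mulr_gt0.
have b1 : 2 * T * (7 * mu * r) <= 56 / 3 * t * (mu * r) by nra.
have b2 : (7 * mu * r + r) * D * 3 <= 24 * D * (mu * r).
  have : r * (D * 3) <= mu * r * (D * 3) by rewrite ler_wpM2r ?mulr_ge0 ?(ltW D0) // ler_peMl ?(ltW r0).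
  lra.
apply: le_trans (_ : 36 * (56 / 3 * t * (mu * r) + 2 * (24 * D * (mu * r))) * t <= _).
  by rewrite ler_wpM2r ?(ltW t0) // ler_wpM2l // lerD // ler_wpM2l.
have -> : 36 * (56 / 3 * t * (mu * r) + 2 * (24 * D * (mu * r))) * t =
  (mu * r) * (672 * t ^+ 2 + 1728 * D * t) by field.
have -> : D * r ^+ 2 * mu ^+ 2 = (mu * r) * (D * (mu * r)) by ring.
rewrite ler_wpM2l ?(ltW mr0) //.
have c1 : 5120 * t ^+ 2 <= D * (K * r) * t ^+ 2 by rewrite ler_wpM2r // exprn_ge0 // (ltW t0).
have c2 : D * (2560 * t) <= D * (K * r * t ^+ 2).
  by rewrite ler_wpM2l ?(ltW D0) // expr2 mulrA; exact: (ler_wpM2r (ltW t0) Kt).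
have c3 : D * (K * r * t ^+ 2) <= D * (mu * r) by rewrite ler_wpM2l // (ltW D0).
have c4 : D * (K * r) * t ^+ 2 = D * (K * r * t ^+ 2) by rewrite !mulrA.
rewrite c4 in c1; rewrite mulrCA in c2; rewrite -mulrA.
have t20 := sqr_ge0 t.
move: c1 c2 c3 t20; move: (D * (K * r * _)) => Y.
move: (D * t) (t ^+ 2) (D * (mu * r)) => e S Z.
clear; lra.
Qed.

Lemma slow_density_step (G : R * R -> R * R) (r x0 K D : R) n :
  continuous (fun p => (G p).1) -> continuous (fun p => (G p).2) ->
  0 < r -> r <= 8^-1 -> 0 < K -> 0 < D -> 64 <= expR x0 ->
  5120 <= D * (K * r) -> 2560 <= K * r * expR (x0 / 2) ->
  strip_expanding G r x0 K ->
  density_le r D x0 (slow G n) -> density_le r D x0 (slow G n.+1).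
Proof.
move=> cG1 cG2 r0 r8 K0 D0 x64 hD hK expandG IH s x y xx.
have arith t T mu (ht : expR (x0 / 2) <= t) := slow_density_arith (t := t) (T := T) (mu := mu)
  r0 r8 K0 D0 hD (le_trans hK (ler_wpM2l (mulr_ge0 (ltW K0) (ltW r0)) ht)).
clear hD hK.
have [mu mux hmu] := expandG _ s xx.
have x64' : 64 <= expR x by apply: (le_trans x64); rewrite ler_expR.
have mu0 : 0 < mu by apply: lt_le_trans mux; rewrite mulr_gt0 // expR_gt0.
(* [T] is the largest slowness threshold e^(|Re p|/2) on the square. It is at least [x0], so the
   induction hypothesis applies to the half-strips beyond it. *)
pose T := expR ((x + r) / 2).
have xT : x0 <= T.
  apply: (le_trans xx); apply: (@le_trans _ _ (x + 1)); first lra.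
  apply: (le_trans (expR_half_ge x64')); rewrite ler_expR; lra.
pose c := (G ((-1) ^+ s * x, y)).2.
(* The image of the square lies within 3 mu r of the height [c] of a corner's image; 7/2 in place of
   3 leaves room for an open strip. *)
pose H := 7 / 2 * mu * r.
have H0 : 0 <= H by rewrite /H !mulr_ge0 // ltW.
have HH : 3 * mu * r < H by rewrite /H; have := mulr_gt0 mu0 r0; lra.
(* The image of a slow point either has |Re| < T or is itself slow within n steps. Openness of [V]
   allows the preimage estimate. *)
pose V : set (R * R) := ([set p | `|p.1| < T] `|` slow G n) `&` [set p | `|p.2 - c| < H].
have oV : open V.
  apply: openI.
    apply: openU; last exact: open_slow.
    have -> : [set p : R * R | `|p.1| < T] = (fun p => `|p.1|) @^-1` [set u | u < T] by [].
    by apply: open_comp; [move=> p _; apply: cvg_norm; exact: cvg_fst|exact: open_lt].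
  have -> : [set p : R * R | `|p.2 - c| < H] = (fun p => `|p.2 - c|) @^-1` [set u | u < H] by [].
  apply: open_comp; last exact: open_lt.
  by move=> p _; apply: cvg_norm; apply: cvgB; [exact: cvg_snd|exact: cvg_cst].
have mG := continuous_measurable_planar cG1 cG2.
have mQ : measurable (sbox s x y r : set T2) by exact: measurable_sbox.
have msn k : measurable (slow G k : set T2) by exact: measurable_slow.
have pc : sbox s x y r ((-1) ^+ s * x, y).
  apply/sboxP; rewrite /= signrMK lexx.
  by split; apply/andP; split => //; lra.
have subQ : sbox s x y r `&` slow G n.+1 `<=` sbox s x y r `&` G @^-1` V.
  move=> p [Qp Bp]; split => //; split; last first.
    have /sboxP[p1 /andP[p2 p3]] := Qp; have /sboxP[q1 /andP[q2 q3]] := pc.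
    have [h _] := hmu _ _ p1 q1 ltac:(rewrite ler_norml; lra).
    exact: le_lt_trans h HH.
  case: Bp => [lt|]; [left|by right].
  apply: (lt_le_trans lt); rewrite /T ler_expR ler_pM2r ?invr_gt0 //.
  have /sboxP[/andP[p1 p2] _] := Qp.
  have -> : `|p.1| = `|(-1) ^+ s * p.1| by rewrite normrMsign.
  by rewrite ger0_norm //; apply: le_trans p1; apply: ltW; rewrite -expR_gt1; lra.
have le1 : (leb2 (sbox s x y r `&` slow G n.+1) <= (36 / mu ^+ 2)%:E * leb2 V)%E.
  apply: (@le_trans _ _ (leb2 (sbox s x y r `&` G @^-1` V))).
    apply: le_measure => //; rewrite inE; apply: measurableI => //.
    by rewrite -[X in measurable X]setTI; apply: mG => //; exact: open_measurable2.
  apply: expanding_preimage_le => // p q d Qp Qq d0 d1 d2.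
  have /sboxP[p1 /andP[p2 p3]] := Qp; have /sboxP[q1 /andP[q2 q3]] := Qq.
  have [_ h] := hmu _ _ p1 q1 ltac:(rewrite ler_norml; lra).
  exact: h d0 d1 d2.
have T0 : 0 < T by exact: expR_gt0.
have g3 := geometric_factor_le r0 r8.
(* The factor e^(-T/2) is bounded by 1, and the geometric factor by 3. *)
have half b : (leb2 (halfstrip b T (c - H) (H + H) `&` slow G n) <=
    (((7 * mu * r + r) * D * 3)%:E))%E.
  apply: (le_trans (leb2_halfstrip_le b (c - H) r0 (ltW D0) _ (msn n) IH xT)).
    by rewrite addr_ge0.
  rewrite lee_fin.
  apply: ler_pM => //.
  - by rewrite !mulr_ge0 ?addr_ge0 ?expR_ge0 // ltW.
  - by rewrite divr_ge0 ?ltW // subr_gt0 expR_lt1 oppr_lt0 divr_gt0.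
  - have -> : H + H + r = 7 * mu * r + r by rewrite /H; field.
    rewrite ler_piMr //.
      by rewrite !mulr_ge0 ?addr_ge0 ?mulr_ge0 // ltW.
    by rewrite expR_le1 oppr_le0 divr_ge0 // ltW.
have leV : (leb2 V <= (2 * T * (7 * mu * r) + 2 * ((7 * mu * r + r) * D * 3))%:E)%E.
  pose W b := halfstrip b T (c - H) (H + H) `&` slow G n.
  have mW b : measurable (W b : set T2) by apply: measurableI => //; exact: measurable_halfstrip.
  have mB : measurable (box (- T) T (c - H) (c + H) : set T2) by exact: measurable_box.
  apply: (@le_trans _ _ (leb2 (box (- T) T (c - H) (c + H) `|` (W false `|` W true)))).
    apply: le_measure; rewrite ?inE; [exact: open_measurable2|by repeat apply: measurableU|].
    move=> p [hp hc]; have {}hc : c - H <= p.2 <= c + H.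
      by move: hc; rewrite /= ltr_norml => /andP[*]; apply/andP; split; lra.
    have [pT|pT] := leP `|p.1| T.
      left; split; rewrite /= in_itv //=; by rewrite -ler_norml.
    have {}hp : slow G n p by case: hp => // /(lt_trans pT); rewrite ltxx.
    right; have [p0|p0] := leP 0 p.1.
      left; split => //; apply/halfstripP; rewrite expr0 mul1r; move: pT; rewrite ger0_norm // => pT.
      by split; [exact: ltW|move: hc; rewrite addrA subrK].
    right; split => //; apply/halfstripP; rewrite expr1 mulN1r; move: pT; rewrite ltr0_norm // => pT.
    by split; [exact: ltW|move: hc; rewrite addrA subrK].
  apply: (le_trans (measureU2 _ _ _)) => //; first exact: measurableU.
  apply: (@le_trans _ _ (leb2 (box (- T) T (c - H) (c + H)) + (leb2 (W false) + leb2 (W true))))%E.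
    by rewrite leeD2l // measureU2.
  apply: (@le_trans _ _ ((2 * T * (7 * mu * r))%:E + (((7 * mu * r + r) * D * 3)%:E + ((7 * mu * r + r) * D * 3)%:E)))%E.
    apply: leeD; last exact: leeD (half false) (half true).
    rewrite leb2_box; [|lra|lra].
    rewrite lee_fin le_eqVlt; apply/orP; left; apply/eqP; by rewrite /H; field.
  rewrite -!EFinD lee_fin le_eqVlt; apply/orP; left; apply/eqP; ring.
apply: (le_trans le1).
apply: (@le_trans _ _ ((36 / mu ^+ 2)%:E * (2 * T * (7 * mu * r) + 2 * ((7 * mu * r + r) * D * 3))%:E)%E).
  by rewrite lee_wpmul2l // lee_fin divr_ge0 // exprn_ge0 // ltW.
(* The parameter is t = e^(x/2); then T = e^(r/2) t <= 4/3 t, and K t^2 = K e^x <= mu. *)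
rewrite -EFinM lee_fin expRN; apply: arith.
- by rewrite ler_expR; lra.
- by apply: le_trans (expR_half_ge x64'); rewrite lerDr ltW // -expR_gt1; lra.
- rewrite /T mulrDl expRD mulrC ler_wpM2r ?expR_ge0 //.
  apply: (le_trans (expR_le_inv _)); first lra.
  rewrite -[leRHS]invrK lef_pV2 ?posrE ?invr_gt0; lra.
- apply: le_trans mux; rewrite -expRM_natl ler_wpM2l ?(ltW K0) // ler_expR.
  lra.
Qed.

(** The induction step reproduces the same constant [D], so the bound passes to the increasing
    union. *)
Lemma slow_density (G : R * R -> R * R) (r x0 K D : R) :
  continuous (fun p => (G p).1) -> continuous (fun p => (G p).2) ->
  0 < r -> r <= 8^-1 -> 0 < K -> 0 < D -> 64 <= expR x0 ->
  5120 <= D * (K * r) -> 2560 <= K * r * expR (x0 / 2) ->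
  strip_expanding G r x0 K -> density_le r D x0 (\bigcup_n slow G n).
Proof.
move=> cG1 cG2 r0 r8 K0 D0 x64 hD hK expandG.
have dn n : density_le r D x0 (slow G n).
  elim: n => [|n IH]; last exact: (slow_density_step cG1 cG2 r0 r8 K0 D0 x64 hD hK expandG IH).
  by move=> s x y _; rewrite setI0 measure0 lee_fin !mulr_ge0 ?expR_ge0 ?sqr_ge0 // ltW.
move=> s x y xx; rewrite setI_bigcupr; apply: leb2_bigcup_le.
- by move=> n; apply: measurableI; [exact: measurable_sbox|exact: measurable_slow].
- move=> n m nm; apply/subsetPset => p [Qp Bp]; split => //.
  by have /subsetPset := nondecreasing_slow G nm; apply.
- by move=> n; exact: dn.
Qed.

End slow_density.

(** * Fast escape and measurability *)

Section planar_continuity.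
Variable R : realType.
Implicit Types (f : R[i] -> R[i]) (g h : R * R -> R[i]).

Definition planar_continuous g :=
  continuous (fun p => complex.Re (g p)) /\ continuous (fun p => complex.Im (g p)).

Lemma planar_continuous_id : planar_continuous (fun p => p.1 +i* p.2).
Proof. by split => p /=; [exact: cvg_fst|exact: cvg_snd]. Qed.

Lemma planar_continuous_cst (c : R[i]) : planar_continuous (fun=> c).
Proof. by split => p; exact: cvg_cst. Qed.

Lemma planar_continuousD g h : planar_continuous g -> planar_continuous h ->
  planar_continuous (fun p => g p + h p).
Proof.
move=> [g1 g2] [h1 h2]; split => p.
- under eq_fun do rewrite raddfD; exact: cvgD (g1 p) (h1 p).
- under eq_fun do rewrite raddfD; exact: cvgD (g2 p) (h2 p).
Qed.

Lemma planar_continuousM g h : planar_continuous g -> planar_continuous h ->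
  planar_continuous (fun p => g p * h p).
Proof.
move=> [g1 g2] [h1 h2]; split => p.
- have -> : (fun p => complex.Re (g p * h p)) =
    (fun p => complex.Re (g p) * complex.Re (h p) - complex.Im (g p) * complex.Im (h p)).
    by apply/funext => q; case: (g q) (h q) => [u v] [u' v'].
  exact: cvgB (cvgM (g1 p) (h1 p)) (cvgM (g2 p) (h2 p)).
- have -> : (fun p => complex.Im (g p * h p)) =
    (fun p => complex.Re (g p) * complex.Im (h p) + complex.Im (g p) * complex.Re (h p)).
    by apply/funext => q; case: (g q) (h q) => [u v] [u' v'].
  exact: cvgD (cvgM (g1 p) (h2 p)) (cvgM (g2 p) (h1 p)).
Qed.

Lemma planar_continuous_cexp g : planar_continuous g -> planar_continuous (fun p => cexp (g p)).
Proof.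
move=> [g1 g2]; have e1 := continuous_comp_fun (@continuous_expR R) g1.
have c2 := continuous_comp_fun (@continuous_cos R) g2.
have s2 := continuous_comp_fun (@continuous_sin R) g2.
by split => p; [exact: cvgM (e1 p) (c2 p)|exact: cvgM (e1 p) (s2 p)].
Qed.

Lemma planar_continuous_expquot (N : nat) (P : {poly R[i]}) : size P = N.+1 ->
  planar_continuous (fun p => expquot P (p.1 +i* p.2)).
Proof.
move=> hP; have -> : (fun p : R * R => expquot P (p.1 +i* p.2)) =
    (fun p => \sum_(j < N.+1) P`_j * cexp ((j%:R - 1 : R)%:C * (p.1 +i* p.2))).
  by apply/funext => p; exact: expquotE.
elim: (N.+1) => [|n IH].
  have -> : (fun p : R * R => \sum_(j < 0) P`_j * cexp ((j%:R - 1 : R)%:C * (p.1 +i* p.2))) = (fun=> 0).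
    by apply/funext => p; rewrite big_ord0.
  exact: planar_continuous_cst.
have -> : (fun p : R * R => \sum_(j < n.+1) P`_j * cexp ((j%:R - 1 : R)%:C * (p.1 +i* p.2))) =
  (fun p : R * R => \sum_(j < n) P`_j * cexp ((j%:R - 1 : R)%:C * (p.1 +i* p.2)) +
     P`_n * cexp ((n%:R - 1 : R)%:C * (p.1 +i* p.2))).
  by apply/funext => p; rewrite big_ord_recr.
apply: planar_continuousD IH _; apply: planar_continuousM (planar_continuous_cst _) _.
apply: planar_continuous_cexp; apply: planar_continuousM (planar_continuous_cst _) _.
exact: planar_continuous_id.
Qed.

Lemma iter_planar f k (p : R * R) :
  iter k f (p.1 +i* p.2) = (iter k (planar f) p).1 +i* (iter k (planar f) p).2.
Proof. by elim: k => //= k ->; rewrite /planar; case: (f _). Qed.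

Lemma continuous_iter_planar f k : planar_continuous (fun p => f (p.1 +i* p.2)) ->
  continuous (iter k (planar f)).
Proof.
move=> [f1 f2]; elim: k => [|k IH]; first by move=> p; exact: cvg_id.
by apply: continuous_comp_fun IH; apply: continuous_pair_fun.
Qed.

Lemma continuous_normc_pair : continuous (fun p : R * R => cabs (p.1 +i* p.2)).
Proof.
apply: (continuous_comp_fun (f := @Num.sqrt R) (g := fun p : R * R => p.1 ^+ 2 + p.2 ^+ 2)).
  exact: sqrt_continuous.
move=> p; apply: cvgD; rewrite expr2.
  by apply: cvgM; exact: cvg_fst.
by apply: cvgM; exact: cvg_snd.
Qed.

End planar_continuity.

(** * Comparison of orbits with the iterated maximum modulus *)

Section fast_escape.
Variable R : realType.
Variables (f : R[i] -> R[i]) (C c : R).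

(** When the set of values is empty or unbounded, [sup] takes the default value 0. *)
Lemma maxmod_ge0 (rho : R) : 0 <= maxmod f rho.
Proof.
rewrite /maxmod; set A := (X in sup X).
have [[[w Aw] ubA]|/sup_out ->//] := pselect (has_sup A).
by apply: le_trans (ub_le_sup ubA Aw); case: Aw => z _ <-; exact: normc_ge0.
Qed.

Lemma maxmod_le (rho : R) : (forall z, cabs (f z) <= C * expR (c * cabs z)) ->
  0 <= rho -> maxmod f rho <= C * expR (c * rho).
Proof.
move=> hf rho0; apply: ge_sup.
  by exists (cabs (f rho%:C)); exists rho%:C => //=; rewrite expr0n /= addr0 sqrtr_sqr ger0_norm.
by move=> _ [z /= <- <-]; exact: hf.
Qed.

(** The quantity |Re| gains at least 1 per step, so it passes any threshold after some time [l].
    From then on y(n+1) >= e^(y(n)/2) outruns M(n+1) <= C e^(c M(n)), because y stays above a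
    multiple of M larger than 2c. *)
Lemma fast_escaping_of_growth (R0 : R) (z : R[i]) :
  (forall z, cabs (f z) <= C * expR (c * cabs z)) -> 0 <= C -> 0 <= c -> 0 <= R0 ->
  64 <= expR `|complex.Re z| ->
  (forall n, expR (`|complex.Re (iter n f z)| / 2) <= `|complex.Re (iter n.+1 f z)|) ->
  fast_escaping f R0 z.
Proof.
move=> hf C0 c0 R00 z64 hy.
pose y n := `|complex.Re (iter n f z)|; pose M n := iter n (maxmod f) R0.
have y64 n : 64 <= expR (y n).
  elim: n => // n IH; apply: (le_trans IH); rewrite ler_expR.
  by apply: le_trans (hy n); apply: le_trans (expR_half_ge IH); rewrite lerDl.
have yn n : n%:R <= y n.
  elim: n => [|n IH]; first exact: normr_ge0.
  rewrite -natr1; apply: le_trans (hy n); apply: le_trans (expR_half_ge (y64 n)).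
  by rewrite lerD2r.
have M0 n : 0 <= M n by case: n => // n; exact: maxmod_ge0.
have MS n : M n.+1 <= C * expR (c * M n) by exact: maxmod_le.
(* The invariant [A * M n + B <= y (n + l)] survives one step because
   [e^(B/2) >= A C + B]. *)
pose A := 2 * c + 2; pose B := 16 + 16 * (A * C).
have A0 : 0 <= A by rewrite /A addr_ge0 // mulr_ge0.
have AC0 : 0 <= A * C by rewrite mulr_ge0.
have B0 : 0 <= B by rewrite /B addr_ge0 // mulr_ge0.
(* With w = A C, e^(B/2) >= (1 + B/4)^2 = (5 + 4w)^2 >= 16 + 17w. *)
have BB : A * C + B <= expR (B / 2).
  have -> : B / 2 = 2%:R * (B / 4) by field.
  rewrite expRM_natl; apply: le_trans (_ : (1 + B / 4) ^+ 2 <= _).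
    by rewrite /B; move: (A * C) AC0 => w w0; nra.
  by rewrite ler_pXn2r ?nnegrE ?expR_ge0 ?addr_ge0 ?divr_ge0 // expR_ge1Dx.
have [l hl] : exists l, A * R0 + B <= y l.
  exists (Num.truncn (A * R0 + B)).+1; apply: le_trans (yn _).
  exact/ltW/truncnS_gt.
exists l => n; apply: le_trans (normc_geRe _).
suff H : A * M n + B <= y (n + l)%N.
  apply: le_trans H; rewrite -[leLHS]addr0 lerD // ler_peMl ?M0 // /A; lra.
elim: n => // n IH; rewrite addSn; apply: le_trans (hy _).
apply: (@le_trans _ _ (expR ((A * M n + B) / 2))); last first.
  by rewrite ler_expR ler_wpM2r.
(* Half of [A] is c + 1: the share c M(n) yields the bound for M(n+1), and the rest, at least B/2,
   pays for A C + B. *)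
have -> : (A * M n + B) / 2 = c * M n + (M n + B / 2) by rewrite /A; field.
rewrite !expRD.
apply: (@le_trans _ _ (expR (c * M n) * (A * C + B))).
  have e1 : 1 <= expR (c * M n) by rewrite -expR0 ler_expR mulr_ge0.
  rewrite mulrDr lerD //; last by rewrite ler_peMl.
  by rewrite [leRHS]mulrCA ler_wpM2l // [leRHS]mulrC MS.
rewrite ler_wpM2l ?expR_ge0 //; apply: (le_trans BB).
by rewrite ler_peMl ?expR_ge0 // -expR0 ler_expR.
Qed.

End fast_escape.

(** The set is a countable union over [l] of countable intersections over [n] of closed sets.
    Measurability gives [area] its meaning as Lebesgue measure. *)
Lemma measurable_fast_escaping {R : realType} (f : R[i] -> R[i]) (R0 : R) :
  planar_continuous (fun p => f (p.1 +i* p.2)) ->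
  measurable ([set p | fast_escaping f R0 (p.1 +i* p.2)] :
    set (measurableTypeR R * measurableTypeR R)%type).
Proof.
move=> cf.
have -> : [set p : R * R | fast_escaping f R0 (p.1 +i* p.2)] =
    \bigcup_l \bigcap_n ~` [set p | cabs (iter (n + l) f (p.1 +i* p.2)) < iter n (maxmod f) R0].
  apply/seteqP; split => p /=.
    by move=> [l hl]; exists l => // n _; apply/negP; rewrite -leNgt.
  by move=> [l _ hl]; exists l => n; rewrite leNgt; apply/negP; exact: hl.
apply: bigcup_measurable => l _; apply: bigcap_measurable => // n _.
apply: measurableC; apply: open_measurable2.
have -> : [set p : R * R | cabs (iter (n + l) f (p.1 +i* p.2)) < iter n (maxmod f) R0] =
    (fun p => cabs (iter (n + l) f (p.1 +i* p.2))) @^-1` [set u | u < iter n (maxmod f) R0] by [].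
apply: open_comp; last exact: open_lt.
move=> p _; move: p.
have -> : (fun p : R * R => cabs (iter (n + l) f (p.1 +i* p.2))) =
    (fun p => cabs ((iter (n + l) (planar f) p).1 +i* (iter (n + l) (planar f) p).2)).
  by apply/funext => p; rewrite iter_planar.
exact: (continuous_comp_fun (@continuous_normc_pair R) (continuous_iter_planar cf)).
Qed.

(** * Area of the complement of the fast escaping set in a strip *)

Theorem theorem3p1 (R : realType) (N : nat) (P : {poly R[i]})
    (hN : (2 <= N)%N) (hP : size P = N.+1) (hP0N : P`_0 * P`_N != 0)
    (R0 : R) (hR0 : 0 < R0) (hesc : maxmod_escapes (expquot P) R0)
    (r c1 xs : R) (hr0 : 0 < r) (hc10 : 0 < c1) (hxs0 : 0 < xs)
    (hr : r <= (4 * N%:R)^-1)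
    (hc1 : 32 * Num.sqrt 2 / (cstK0 N P * r) + (4 * cstK0 N P ^+ 2)^-1
             + 12 * Num.sqrt 2 / cstK0 N P <= c1)
    (hxs : Num.max (Num.max (cstR3 N P) (cstR6 N P))
             (Num.max (6 * ln 2) (12 + 2 * ln c1)) <= xs)
    (a : R) :
  (area (hstrip a `&` ~` fast_escaping (expquot P) R0)
     <= ((4 * pi + 4 * r) *
         (xs + r + 8 * c1 * expR (4 - xs / 2) *
            (r / (1 - expR (- (r / 2))))))%:E
     < +oo)%E.
Proof.
rewrite ltry andbT.
have N0 : (0 < N)%N by exact: leq_trans hN.
have N2 : 2 <= N%:R :> R by rewrite ler_nat.
move: hxs; rewrite !ge_max => /andP[/andP[hR3 _] /andP[hln2 hlnc]].
have K00 : 0 < cstK0 N P.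
  have pos (z : R[i]) : z != 0 -> 0 < cabs z.
    move=> z0; rewrite lt_neqAle normc_ge0 andbT eq_sym; apply: contra z0 => /eqP h.
    by apply/eqP; exact: ComplexField.Normc.eq0_normc.
  by move: hP0N; rewrite mulf_eq0 negb_or => /andP[h1 h2]; rewrite /cstK0 lt_min !pos.
have e1 : 9 / 4 <= expR 1 :> R.
  have -> : 1 = 2%:R * 2^-1 :> R by field.
  rewrite expRM_natl; have := expR_ge1Dx (2^-1 : R).
  by move: (expR _) => u hu; nra.
(* The first summand of the lower bound for [c1] gives 32 sqrt 2 >= 32 * 5/4 = 40. *)
have hc : 40 <= cstK0 N P * r * c1.
  have A0 : 0 < cstK0 N P * r by rewrite mulr_gt0.
  have s2 : 5 / 4 <= Num.sqrt 2 :> R.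
    have -> : 5 / 4 = Num.sqrt ((5 / 4) ^+ 2) :> R by rewrite sqrtr_sqr ger0_norm //; lra.
    by rewrite ler_sqrt; lra.
  rewrite mulrC -ler_pdivrMr //; apply: le_trans hc1.
  have t2 : 0 <= (4 * cstK0 N P ^+ 2)^-1 by rewrite invr_ge0 mulr_ge0 // exprn_ge0 // ltW.
  have t3 : 0 <= 12 * Num.sqrt 2 / cstK0 N P by rewrite divr_ge0 ?mulr_ge0 ?sqrtr_ge0 // ltW.
  apply: le_trans (_ : 32 * Num.sqrt 2 / (cstK0 N P * r) <= _); last by lra.
  by rewrite ler_pM2r ?invr_gt0 //; lra.
have x64 : 64 <= expR xs.
  have e2 : expR (ln 2) = 2 :> R by rewrite lnK // posrE.
  have e6 : expR (6%:R * ln 2) = 64 :> R by rewrite expRM_natl e2; ring.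
  by rewrite -e6 ler_expR.
(* This is the choice of R_3, whose exponential is 2 + 8K/K_0. *)
have x8 : 8 * cstK N P <= cstK0 N P * expR xs.
  have q0 : 0 <= 8 * cstK N P / cstK0 N P by rewrite divr_ge0 ?mulr_ge0 ?cstK_ge0 // ltW.
  have p0 : 2 + 8 * cstK N P / cstK0 N P \is Num.pos by rewrite posrE; lra.
  have : 2 + 8 * cstK N P / cstK0 N P <= expR xs by rewrite -[leLHS](lnK p0) ler_expR.
  move=> h; rewrite [leRHS]mulrC -ler_pdivrMr //; lra.
(* From x* >= 12 + 2 ln c_1 follows e^(x*/2) >= e^6 c_1, and e^6 >= (9/4)^6 > 64. *)
have xc : 64 * c1 <= expR (xs / 2).
  apply: (@le_trans _ _ (expR (6 + ln c1))); last by rewrite ler_expR; lra.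
  rewrite expRD lnK ?posrE // ler_wpM2r ?(ltW hc10) //.
  have -> : 6 = 6%:R * 1 :> R by rewrite mulr1.
  rewrite expRM_natl; apply: le_trans (_ : (9 / 4) ^+ 6 <= _); last by rewrite ler_pXn2r ?nnegrE ?expR_ge0 //; lra.
  by lra.
have e4 : 16 <= expR 4 :> R.
  have -> : 4 = 4%:R * 1 :> R by rewrite mulr1.
  rewrite expRM_natl; apply: le_trans (_ : (9 / 4) ^+ 4 <= _); last by rewrite ler_pXn2r ?nnegrE ?expR_ge0 //; lra.
  by lra.
pose D := 8 * c1 * expR 4.
have D0 : 0 < D by rewrite /D !mulr_gt0 // expR_gt0.
have hr4 : N%:R * r <= 4^-1.
  apply: le_trans (_ : N%:R * (4 * N%:R)^-1 <= _); first by rewrite ler_wpM2l.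
  by rewrite invfM mulrCA mulfV ?mulr1 // gt_eqF //; lra.
have r8 : r <= 8^-1.
  by have := ler_wpM2r (ltW hr0) N2; lra.
(* Here 5120 = 8 * 16 * 40 by [e4] and [hc]; below, 2560 = 64 * 40 by [xc] and [hc]. *)
have Dc : 5120 <= D * (cstK0 N P * r).
  have -> : D * (cstK0 N P * r) = 8 * expR 4 * (cstK0 N P * r * c1) by rewrite /D; ring.
  apply: le_trans (_ : 128 * (cstK0 N P * r * c1) <= _); first by lra.
  by rewrite ler_wpM2r ?mulr_ge0 ?(ltW K00) ?(ltW hr0) ?(ltW hc10) //; lra.
have xK : 2560 <= cstK0 N P * r * expR (xs / 2).
  apply: le_trans (_ : cstK0 N P * r * (64 * c1) <= _); first by lra.
  by rewrite ler_wpM2l ?mulr_ge0 ?(ltW K00) ?(ltW hr0).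
have cf := planar_continuous_expquot hP.
pose G := planar (expquot P).
have hG : strip_expanding G r xs (cstK0 N P).
  move=> x s xx; apply: expquot_expanding => //.
    by apply: (le_trans x64); rewrite ler_expR.
  by apply: (le_trans x8); rewrite ler_wpM2l ?(ltW K00) // ler_expR.
have cG1 : continuous (fun p => (G p).1) by exact: cf.1.
have cG2 : continuous (fun p => (G p).2) by exact: cf.2.
have dens := slow_density cG1 cG2 hr0 r8 K00 D0 x64 Dc xK hG.
clear Dc xK hc hc1 hlnc.
pose B : set (R * R) := \bigcup_n slow G n.
have mB : measurable (B : set (measurableTypeR R * measurableTypeR R)%type).
  by apply: bigcup_measurable => n _; exact: measurable_slow.
have pi0 : 0 <= pi :> R by exact: pi_ge0.
pose W b := halfstrip b xs a (2 * pi) `&` B.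
have mW b : measurable (W b : set (measurableTypeR R * measurableTypeR R)%type).
  by apply: measurableI => //; exact: measurable_halfstrip.
have mX : measurable (box (- xs) xs a (a + 2 * pi) : set (measurableTypeR R * measurableTypeR R)%type).
  exact: measurable_box.
set S := [set p : R * R | (hstrip a `&` ~` fast_escaping (expquot P) R0) (p.1 +i* p.2)].
have mS : measurable (S : set (measurableTypeR R * measurableTypeR R)%type).
  have -> : S = (setT `*` `[a, a + 2 * pi]%classic) `&` ~` [set p | fast_escaping (expquot P) R0 (p.1 +i* p.2)].
    by apply/seteqP; split => p [h1 h2]; split => //; move: h1; rewrite /hstrip /= in_itv //= => -[].
  apply: measurableI; first by apply: measurableX => //; exact: measurable_itv.
  by apply: measurableC; exact: measurable_fast_escaping.
have subS : S `<=` box (- xs) xs a (a + 2 * pi) `|` (W false `|` W true).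
  move=> p [h1 h2]; rewrite /hstrip /= in h1.
  have [px|px] := leP `|p.1| xs.
    by left; split; rewrite /= in_itv //= -ler_norml.
  (* A point beyond x* that is never slow escapes fast, so the points of the strip outside the
     central box are slow. *)
  have Bp : B p.
    apply: contrapT => nB; apply: h2.
    apply: (@fast_escaping_of_growth _ _ (N.+1%:R * cstK N P) N%:R) => //.
    - by move=> z; exact: normc_expquot_le.
    - by rewrite mulr_ge0 ?cstK_ge0.
    - exact: ltW.
    - by apply: (le_trans x64); rewrite ler_expR ltW.
    - by move=> n; rewrite !iter_planar; exact: not_slow_growth.
  right; have [p0|p0] := leP 0 p.1.
    left; split => //; apply/halfstripP; rewrite expr0 mul1r; split => //.
    by move: px; rewrite ger0_norm // => /ltW.
  right; split => //; apply/halfstripP; rewrite expr1 mulN1r; split => //.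
  by move: px; rewrite ltr0_norm // => /ltW.
set g := r / (1 - expR (- (r / 2))).
have g0 : 0 <= g by rewrite divr_ge0 ?(ltW hr0) // subr_ge0 expR_le1 oppr_le0 divr_ge0 // ltW.
have EW b : (product_measure1 lebesgue_measure lebesgue_measure (W b) <=
    ((2 * pi + r) * D * expR (- (xs / 2)) * g)%:E)%E.
  by apply: leb2_halfstrip_le (lexx xs) => //; rewrite ?mulr_ge0 // ltW.
have EX : (product_measure1 lebesgue_measure lebesgue_measure (box (- xs) xs a (a + 2 * pi)) <=
    (4 * pi * xs)%:E)%E.
  by rewrite leb2_box; [rewrite lee_fin; lra|lra|lra].
rewrite /area -/S.
apply: (@le_trans _ _ (product_measure1 lebesgue_measure lebesgue_measure
    (box (- xs) xs a (a + 2 * pi) `|` (W false `|` W true)))).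
  by apply: le_measure; rewrite ?inE //; repeat apply: measurableU.
apply: (le_trans (measureU2 _ _ _)) => //; first exact: measurableU.
apply: (@le_trans _ _ ((4 * pi * xs)%:E + (((2 * pi + r) * D * expR (- (xs / 2)) * g)%:E +
    ((2 * pi + r) * D * expR (- (xs / 2)) * g)%:E)))%E.
  apply: leeD; first exact: EX.
  by apply: (le_trans (measureU2 _ _ _)) => //; exact: leeD (EW false) (EW true).
(* With w = D e^(-x*/2) g, what remains is 4 pi x* + (4 pi + 2r) w <= (4 pi + 4r)(x* + r + w), whose
   two sides differ by a sum of nonnegative products. *)
rewrite -!EFinD lee_fin.
have -> : expR (4 - xs / 2) = expR 4 * expR (- (xs / 2)) by rewrite -expRD.
have -> : 8 * c1 * (expR 4 * expR (- (xs / 2))) * g = D * expR (- (xs / 2)) * g by rewrite /D; ring.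
have -> : (2 * pi + r) * D * expR (- (xs / 2)) * g = (2 * pi + r) * (D * expR (- (xs / 2)) * g) by ring.
have : 0 <= D * expR (- (xs / 2)) * g.
  exact: mulr_ge0 (mulr_ge0 (ltW D0) (expR_ge0 _)) g0.
move: (D * expR (- (xs / 2)) * g) => w w0.
have := mulr_ge0 (ltW hr0) w0; have := mulr_ge0 pi0 (ltW hr0); have := mulr_ge0 (ltW hr0) (ltW hxs0).
have := mulr_ge0 (ltW hr0) (ltW hr0); lra.
Qed.
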